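(* Let $G$ be a finite cell complex given by a subset of the quadrilaterals of the $\mathbb{Z}^2$ lattice, with $G$ and its dual $G^*$ simply connected, let $V_B$ be the set of boundary vertices of $G$ and $|E(G)|$ the number of edges of $G$. Fix the ring area. Orthogonal ring patterns on $G$ can be obtained as solutions of the following boundary value problems: (Dirichlet boundary conditions) For any choice of prescribed $\rho$-radii $\rho:V_B\to\mathbb{R}_+$ of the boundary rings there exists a unique orthogonal ring pattern $\mathcal{R}$ on $G$ with these boundary $\rho$-radii. (Neumann boundary conditions) For any choice of boundary cone angles $\Theta:V_B\to\mathbb{R}_+$ satisfying $$\sum_{v_i\in V(G)}\Phi_i=\pi|E(G)|,\qquad \Phi_i=\begin{cases}2\pi&\text{for interior vertices } v_i,\\ \Theta_i&\text{for boundary vertices } v_i\in V_B,\end{cases}$$ there exists a one-parameter family of orthogonal ring patterns $\mathcal{R}_h$ on $G$, where the parameter $h$ is given by the shift $\rho_i\to\rho_i+h$ for all $i$. There exists $h_0$ such that for all $h>h_0$ all boundary rings of the ring pattern $\mathcal{R}_h$ are positively oriented.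
   Context: **Complex.** $G$ is a cell complex defined by a subset of the quadrilaterals (unit squares) of the $\mathbb{Z}^2$ lattice in $\mathbb{R}^2$, with vertices $v_{m,n}$, $(m,n)\in\mathbb{Z}^2$, and horizontal edges $(v_{m,n},v_{m+1,n})$ and vertical edges $(v_{m,n},v_{m,n+1})$. Interior vertices have four neighbors; the set $V_B$ of boundary vertices consists of the vertices with fewer than four neighbors. The dual complex $G^*$ has the 2-cells of $G$ as vertices, and its edges correspond to the edges of $G$ shared by two neighboring 2-cells. $\mathbb{R}_+$ denotes the positive reals. **Rings.** A ring is a pair of concentric circles in $\mathbb{R}^2$: an inner circle $c$ of signed radius $r\in\mathbb{R}$ and an outer circle $C$ of radius $R>0$, the area being $\pi(R^2-r^2)$. $r>0$ (positively oriented ring) corresponds to counter-clockwise and $r<0$ to clockwise orientation; if $r=0$ the inner circle degenerates to its center, and orthogonal intersection of $C'$ with $c$ means that $C'$ passes through that point. **Orthogonal ring pattern on $G$.** An assignment of rings to the vertices of $G$ (centers identified with vertices) such that: (i) rings at neighboring vertices $v_i,v_j$ intersect orthogonally, i.e. $C_i$ intersects $c_j$ orthogonally and $C_j$ intersects $c_i$ orthogonally; (ii) in each square of $G$ the inner circles $c_{m,n}$, $c_{m+1,n+1}$ and the outer circles $C_{m,n+1}$, $C_{m+1,n}$ pass through one point (then the two inner circles touch and the two outer circles touch at this point); (iii) for any ring $(C_{m,n},c_{m,n})$ the four touching points $C_{m,n}\cap C_{m+1,n-1}$, $c_{m,n}\cap c_{m+1,n+1}$, $C_{m,n}\cap C_{m-1,n+1}$,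 $c_{m,n}\cap c_{m-1,n-1}$ are in counter-clockwise order if $r_{m,n}>0$ and in clockwise order if $r_{m,n}<0$. **$\rho$-radii.** All rings of an orthogonal ring pattern have the same area $\pi\ell_0^2$, so $R_i^2-r_i^2=\ell_0^2$; the $\rho$-radius $\rho_i\in\mathbb{R}$ is defined by $R_i=\ell_0\cosh\rho_i$, $r_i=\ell_0\sinh\rho_i$. Ring patterns are considered up to Euclidean motion. **Cone angles and equations.** For neighboring $v_i,v_j$, let $\varphi_{ij}$ be the signed angle at $v_i$ of the cyclic quadrilateral formed by the two centers and the intersection points $p\in c_i\cap C_j$, $q\in C_i\cap c_j$: for $\rho_i\ne0$, the angle at $v_i$ of the right triangle $v_i,p,v_j$ with legs $|r_i|,R_j$ (with the sign of $\rho_i$) plus the angle at $v_i$ of the right triangle $v_i,q,v_j$ with legs $R_i,|r_j|$ (with the sign of $\rho_j$). The cone angle at $v_i$ is $\Theta_i=\sum_{j:\,v_j\sim v_i}\varphi_{ij}$, the sum over all neighbors of $v_i$. When all boundary rings are positively oriented, the $\rho$-radii of an orthogonal ring pattern with boundary cone angles $\Theta_i$ are characterized by $$\Phi_i+\sum_{j:\,v_j\sim v_i}\left(2\arctan(e^{\rho_i-\rho_j})-\pi\right)=0\quad\text{for all } v_i\in V(G),$$ with $\Phi_i=2\pi$ at interior vertices and $\Phi_i=\Theta_i$ at boundary vertices. In the Dirichlet problem these equations are imposed at interior vertices only; in the Neumann problem at all vertices, and $\mathcal{R}_h$ denotes the ring pattern with $\rho$-radii $\rho_i+h$, where $\rho$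 is a solution of these equations.
   Formalization: Neumann data must also satisfy: over each nonempty proper vertex set, the sum of Φ is < π times the number of edges meeting it (necessary for existence). Patterns must have unfolded squares, with touching sides fixed by the radii's signs, and satisfy the cone-angle equation at interior vertices. *)

(* Defs.v *)
From mathcomp Require Import all_boot all_order all_algebra finmap.
From mathcomp Require Import reals sequences exp trigo.
Set Implicit Arguments.
Unset Strict Implicit.
Unset Printing Implicit Defensive.
Import Order.TTheory GRing.Theory Num.Theory.
Local Open Scope fset_scope.
Local Open Scope ring_scope.

(** * Square complexes in the lattice Z^2 *)

(* A lattice point (m, n) stands both for the vertex v_{m,n} and for the unit
   square having v_{m,n} as lower left corner.  A finite complex G given by
   quadrilaterals is the finite set of (lower left corners of) its squares. *)
Definition lattice_point := (int * int)%type.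
Definition e1 : lattice_point := (1, 0).
Definition e2 : lattice_point := (0, 1).

(* Counter-clockwise boundary cycle of the square q. *)
Definition corners (q : lattice_point) : seq lattice_point :=
  [:: q; q + e1; q + e1 + e2; q + e2].

(* An edge is recorded as (v, v + e1) or (v, v + e2), so each undirected edge
   is listed once. *)
Definition sides (q : lattice_point) : seq (lattice_point * lattice_point) :=
  [:: (q, q + e1); (q + e2, q + e2 + e1); (q, q + e2); (q + e1, q + e1 + e2)].

Section Complex.
Variable G : {fset lattice_point}.

Definition vertices : {fset lattice_point} :=
  [fset v in flatten [seq corners q | q <- G]].

Definition edges : {fset lattice_point * lattice_point} :=
  [fset e in flatten [seq sides q | q <- G]].

Definition adjacent : rel lattice_point :=
  [rel v w | ((v, w) \in edges) || ((w, v) \in edges)].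

Definition neighbors (v : lattice_point) : {fset lattice_point} :=
  [fset w in vertices | adjacent v w].

Definition boundary_vertices : {fset lattice_point} :=
  [fset v in vertices | (#|` neighbors v | < 4)%N].

Definition interior_vertices : {fset lattice_point} :=
  [fset v in vertices | #|` neighbors v | == 4%N].

(* Adjacency in G^*: distinct squares of G with a common edge. *)
Definition dual_adjacent : rel lattice_point :=
  [rel q q' | [&& q \in G, q' \in G, q != q' & has (mem (sides q')) (sides q)]].

(* The 2-cells of G^* are dual to the vertices around which G has all four
   squares; the face q is dual to the vertex q + e1 + e2 and has the four
   squares around that vertex as its corners. *)
Definition dual_face : pred lattice_point := [pred q | all (mem G) (corners q)].

End Complex.

(* Combinatorial homotopy, with fixed end points, of edge paths in a 2-complex
   with adjacency E whose 2-cells are the unit squares satisfying F. *)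
Inductive homotopic (E : rel lattice_point) (F : pred lattice_point) :
    seq lattice_point -> seq lattice_point -> Prop :=
| homotopic_refl s : homotopic E F s s
| homotopic_sym s t : homotopic E F s t -> homotopic E F t s
| homotopic_trans s t u :
    homotopic E F s t -> homotopic E F t u -> homotopic E F s u
| homotopic_spur a b x y : E x y ->
    homotopic E F (a ++ [:: x; y; x] ++ b) (a ++ [:: x] ++ b)
| homotopic_face a b q k x y z w : F q -> rot k (corners q) = [:: x; y; z; w] ->
    homotopic E F (a ++ [:: x; y; z] ++ b) (a ++ [:: x; w; z] ++ b).

Definition simply_connected (V : {fset lattice_point}) (E : rel lattice_point)
    (F : pred lattice_point) : Prop :=
  [/\ V != fset0,
      forall x y, x \in V -> y \in V -> exists2 p, path E x p & last x p = y
    & forall x p, x \in V -> path E x p -> last x p = x ->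
        homotopic E F (x :: p) [:: x]].

Definition complex_simply_connected (G : {fset lattice_point}) : Prop :=
  simply_connected (vertices G) (adjacent G) (mem G).

Definition dual_simply_connected (G : {fset lattice_point}) : Prop :=
  simply_connected G (dual_adjacent G) (dual_face G).

(** * Plane geometry *)

Definition plane (R : realType) : Type := (R * R)%type.

Section Plane.
Variable R : realType.
Implicit Types (a b c p : plane R) (s t : R).

Definition sqdist a b : R := (a.1 - b.1) ^+ 2 + (a.2 - b.2) ^+ 2.

(* Twice the signed area of the triangle a b c. *)
Definition orient a b c : R :=
  (b.1 - a.1) * (c.2 - a.2) - (b.2 - a.2) * (c.1 - a.1).

(* Circles are given by a center and a radius whose sign is irrelevant here. *)
Definition on_circle a s p : Prop := sqdist a p = s ^+ 2.

(* For s = 0 this says that the second circle passes through a. *)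
Definition orthogonal_circles a s b t : Prop := sqdist a b = s ^+ 2 + t ^+ 2.

Definition polar a s (theta : R) : plane R :=
  (a.1 + s * cos theta, a.2 + s * sin theta).

(* The orientation preserving Euclidean motion with rotation part (c, s),
   where c ^+ 2 + s ^+ 2 = 1, and translation part b. *)
Definition motion (c s : R) b p : plane R :=
  (c * p.1 - s * p.2 + b.1, s * p.1 + c * p.2 + b.2).

Definition cosh (x : R) : R := (expR x + expR (- x)) / 2.
Definition sinh (x : R) : R := (expR x - expR (- x)) / 2.

End Plane.

(** * Orthogonal ring patterns *)

Record planar_ring (R : realType) := PlanarRing {
  center : plane R;
  inner : R;    (* signed radius r of the inner circle *)
  outer : R }.  (* radius of the outer circle *)

Section RingPatterns.
Variable R : realType.

Definition pattern := lattice_point -> planar_ring R.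

Definition positively_oriented (C : planar_ring R) : Prop := 0 < inner C.

Definition ring_area (C : planar_ring R) : R :=
  pi * (outer C ^+ 2 - inner C ^+ 2).

Definition has_rho_radius (l : R) (C : planar_ring R) (rho : R) : Prop :=
  outer C = l * cosh rho /\ inner C = l * sinh rho.

Definition orthogonal_rings (C D : planar_ring R) : Prop :=
  orthogonal_circles (center C) (outer C) (center D) (inner D) /\
  orthogonal_circles (center D) (outer D) (center C) (inner C).

(* The signed angle phi_ij at the center of C of the quadrilateral spanned by
   neighboring rings C and D: each right triangle contributes with the sign of
   the radius of the inner circle it involves.  When inner C = 0 the first
   summand vanishes since Num.sg 0 = 0. *)
Definition kite_angle (C D : planar_ring R) : R :=
  Num.sg (inner C) * atan (outer D / `|inner C|) +
  Num.sg (inner D) * atan (`|inner D| / outer C).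

Section OnComplex.
Variable G : {fset lattice_point}.

Definition cone_angle (P : pattern) (v : lattice_point) : R :=
  \sum_(w <- neighbors G v) kite_angle (P v) (P w).

(* Circles of a square of G through a common point t.  Radii being signed, the
   inner circles touch from outside if their orientations agree and from
   inside otherwise; outer circles always touch from outside.  In the right
   triangle formed by t and the two centers on a side of the square, t lies on
   the side of the edge (seen along the counter-clockwise boundary of the
   square) given by the sign of the inner radius involved; this is the sign
   convention of kite_angle, which also determines how the rings of a square
   without adjacent squares are placed. *)
Definition touching_square (P : pattern) (q : lattice_point)
    (t : plane R) : Prop :=
  let A := P q in
  let B := P (q + e1) in
  let C := P (q + e1 + e2) in
  let D := P (q + e2) in
  [/\ [/\ on_circle (center A) (inner A) t,
          on_circle (center C) (inner C) t,
          on_circle (center B) (outer B) t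
        & on_circle (center D) (outer D) t],
      sqdist (center A) (center C) = (inner A + inner C) ^+ 2,
      sqdist (center B) (center D) = (outer B + outer D) ^+ 2
    & [/\ Num.sg (orient (center A) (center B) t) = Num.sg (inner A),
          Num.sg (orient (center B) (center C) t) = Num.sg (inner C),
          Num.sg (orient (center C) (center D) t) = Num.sg (inner C)
        & Num.sg (orient (center D) (center A) t) = Num.sg (inner A)]].

(* Cyclic order of the touching points t on the ring at v, in the lower right,
   upper right, upper left and lower left squares; the angles a_k increase
   within one turn, and are negated if the ring is negatively oriented.  At
   vertices with fewer than four squares only the existing touching points are
   constrained. *)
Definition touching_points_ordered (P : pattern) (t : lattice_point -> plane R)
    (v : lattice_point) : Prop :=
  let: PlanarRing z r Rad := P v in
  r != 0 ->
  exists a1 a2 a3 a4 : R,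
    [/\ a1 < a2, a2 < a3, a3 < a4 & a4 < a1 + 2 * pi] /\
    [/\ v - e2 \in G -> t (v - e2) = polar z Rad (Num.sg r * a1),
        v \in G -> t v = polar z `|r| (Num.sg r * a2),
        v - e1 \in G -> t (v - e1) = polar z Rad (Num.sg r * a3)
      & v - e1 - e2 \in G ->
        t (v - e1 - e2) = polar z `|r| (Num.sg r * a4)].

(* The last clause follows from the others at a vertex surrounded by four
   squares.  It is needed at a vertex with four neighbors but only three
   squares, which counts as interior although it lies on the topological
   boundary of G. *)
Definition ring_pattern (P : pattern) : Prop :=
  [/\ forall v, v \in vertices G -> 0 < outer (P v),
      forall v w, adjacent G v w -> orthogonal_rings (P v) (P w),
      exists t : lattice_point -> plane R,
        (forall q, q \in G -> touching_square P q (t q)) /\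
        (forall v, v \in vertices G -> touching_points_ordered P t v)
    & forall v, v \in interior_vertices G ->
        cone_angle P v = 2 * pi * Num.sg (inner (P v))].

Definition has_area (P : pattern) (a : R) : Prop :=
  forall v, v \in vertices G -> ring_area (P v) = a.

Definition congruent (P Q : pattern) : Prop :=
  exists c s b, c ^+ 2 + s ^+ 2 = 1 /\
    forall v, v \in vertices G ->
      [/\ center (Q v) = motion c s b (center (P v)),
          inner (Q v) = inner (P v) & outer (Q v) = outer (P v)].

(* Prescribed cone angles Phi: 2 pi at interior vertices, Theta on V_B. *)
Definition prescribed_angle (Theta : lattice_point -> R)
    (v : lattice_point) : R :=
  if v \in boundary_vertices G then Theta v else 2 * pi.

(* Left hand side of the equation for the rho-radii at v. *)
Definition rho_equation (Phi rho : lattice_point -> R)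
    (v : lattice_point) : R :=
  Phi v + \sum_(w <- neighbors G v) (2 * atan (expR (rho v - rho w)) - pi).

(* Each edge of G carries the total angle pi, split into two positive angles
   at its end points.  So the cone angles at the vertices of a proper subset W
   sum to less than pi times the number of edges having an end point in W. *)
Definition admissible_angles (Phi : lattice_point -> R) : Prop :=
  forall W : {fset lattice_point}, W `<=` vertices G -> W != fset0 ->
    W != vertices G ->
    \sum_(v <- W) Phi v <
      pi * #|` [fset e in edges G | (e.1 \in W) || (e.2 \in W)] |%:R.

End OnComplex.
End RingPatterns.

(* Main.v *)
Require Import Defs.
From mathcomp Require Import all_boot all_order all_algebra finmap.
From mathcomp Require Import reals sequences exp trigo.
From mathcomp Require Import boolp classical_sets normedtype derive realfun.
From mathcomp Require Import zify ring lra.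
Import Order.TTheory GRing.Theory Num.Theory.
Import numFieldNormedType.Exports.
Local Open Scope fset_scope.
Local Open Scope ring_scope.
Set Implicit Arguments.
Unset Strict Implicit.
Unset Printing Implicit Defensive.

(* With gd x = 2 atan(e^x) - pi/2, the signed kite angle at v towards w is
   sg(rho_v) pi/2 - gd(rho_v - rho_w). Hence at interior vertices, whatever the
   signs of the rings, the cone angle condition reads
   sum_w gd(rho_v - rho_w) = 0.

   From rho to the pattern: in the square q, let alpha_q be the direction from
   the center at q to the touching point. With r and R the signed inner and the
   outer radii, the sides of the square are e^(i alpha_q) (r +- i R), and the
   squares on both sides of an edge (v, w) fit together iff their directions
   differ by +-gd(rho_v - rho_w). Around a full interior vertex these increments
   cancel, so simple connectedness of the dual yields alpha; the resulting edge
   vectors close up around each square, so simple connectedness of G yields the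
   centers. Touching points at a vertex are in the right order because
   consecutive directions differ by less than pi/2; this needs that no vertex
   lies on exactly two opposite squares, which again follows from both
   connectedness hypotheses.

   Solving for rho: by Perron's method, a solution is the supremum of
   subsolutions lying above an obstacle. For Dirichlet data the obstacle 0 and
   the maximum principle suffice. For Neumann data, a function with large
   oscillation has a large gap between its values; summing the equations over
   the vertices below the gap contradicts the admissibility of the angles.

   Uniqueness: rho is determined and positive by the maximum principle, a square
   with positive rings is determined up to a motion by its radii, and the
   motions of adjacent squares agree along their common edge. *)

(** * The Gudermannian function and its rotation identities *)

Section Gudermannian.
Variable R : realType.
Implicit Types a b x y : R.

(* The Gudermannian function: the summand [2 * atan (expR x) - pi] of the
   rho-equation is [gd x - pi / 2], and [gd] is odd. *)
Definition gd x : R := 2 * atan (expR x) - pi / 2.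

Lemma cosh_gt0 x : 0 < cosh x.
Proof. by rewrite divr_gt0// addr_gt0// expR_gt0. Qed.

Lemma cosh2Bsinh2 x : cosh x ^+ 2 - sinh x ^+ 2 = 1.
Proof.
rewrite /cosh /sinh; have := expRxMexpNx_1 x.
move: (expR x) (expR (- x)) => u v; nra.
Qed.

Lemma coshDsinh x : cosh x + sinh x = expR x.
Proof. by rewrite /cosh /sinh; field. Qed.

Lemma sinhB x y : sinh (x - y) = sinh x * cosh y - cosh x * sinh y.
Proof. by rewrite /sinh /cosh opprB !expRD; field. Qed.

Lemma coshB x y : cosh (x - y) = cosh x * cosh y - sinh x * sinh y.
Proof. by rewrite /sinh /cosh opprB !expRD; field. Qed.

Lemma sgr_sinh x : Num.sg (sinh x) = Num.sg x.
Proof.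
rewrite /sinh sgrM (gtr0_sg (_ : 0 < 2^-1)) ?invr_gt0 ?mulr1//.
case: (ltrgt0P x) => [x0|x0|->].
- by rewrite !gtr0_sg// subr_gt0 ltr_expR; lra.
- by rewrite !ltr0_sg// subr_lt0 ltr_expR; lra.
- by rewrite oppr0 subrr.
Qed.

Lemma cos_atan_gt0 x : 0 < cos (atan x).
Proof. by apply: cos_gt0_pihalf; rewrite atan_gtNpi2 atan_ltpi2. Qed.

Lemma sin_atan x : sin (atan x) = x * cos (atan x).
Proof. by rewrite -{2}(atanK x) /tan divfK// gt_eqF// cos_atan_gt0. Qed.

Lemma cos_atan2 x : cos (atan x) ^+ 2 * (1 + x ^+ 2) = 1.
Proof. by rewrite -[RHS](cos2Dsin2 (atan x)) sin_atan; ring. Qed.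

Lemma gd_gt x : - (pi / 2) < gd x.
Proof.
rewrite /gd; have : 0 < atan (expR x) by rewrite -atan0 lt_atan// expR_gt0.
by lra.
Qed.

Lemma gd_lt x : gd x < pi / 2.
Proof. by rewrite /gd; have := atan_ltpi2 (expR x); lra. Qed.

Lemma ltr_gd : {homo gd : x y / x < y}.
Proof.
move=> x y xy; rewrite /gd ltrD2r ltr_pM2l ?lt_atan ?ltr_expR//.
Qed.

Lemma ler_gd : {homo gd : x y / x <= y}.
Proof. by move=> x y; rewrite le_eqVlt => /predU1P[->//|/ltr_gd/ltW]. Qed.

Lemma gd0 : gd 0 = 0.
Proof. by rewrite /gd expR0 atan1; field. Qed.

(** With [u = expR x], the double angle formula gives [cos (gd x) = sin (2 atan u) = 2u / (1 +
    u^2)]. *)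
Lemma cos_gd x : cos (gd x) * cosh x = 1.
Proof.
rewrite /gd cosBpihalf -[2]/(1 + 1) mulrDl mul1r sinD sin_atan.
have := cos_atan2 (expR x); rewrite /cosh; have := expRxMexpNx_1 x.
move: (expR x) (expR (- x)) (cos _) => u v c uv h.
have -> : (u * c * c + c * (u * c)) * ((u + v) / 2) =
    c ^+ 2 * (u * v + u ^+ 2) by field.
by rewrite uv.
Qed.

Lemma sin_gd x : sin (gd x) * cosh x = sinh x.
Proof.
rewrite /gd sinBpihalf -[2]/(1 + 1) mulrDl mul1r cosD sin_atan.
have := cos_atan2 (expR x); rewrite /cosh /sinh; have := expRxMexpNx_1 x.
move: (expR x) (expR (- x)) (cos _) => u v c uv h.
transitivity (c ^+ 2 * (u ^+ 3 + u * (u * v) - u - v) / 2); first by field.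
rewrite (_ : u - v = (u - v) * (c ^+ 2 * (1 + u ^+ 2))); last by rewrite h mulr1.
rewrite uv mulr1.
transitivity (c ^+ 2 * (u ^+ 3 + u - u * (u * v) - v) / 2); last by field.
by rewrite uv; field.
Qed.

(** Halving the angle gives [sin (x / 2) = 0], and 0 is the only zero of sine between -pi and pi.
    Below, angles are identified by applying this to their difference. *)
Lemma cos_eq1_small x : - (2 * pi) < x -> x < 2 * pi -> cos x = 1 -> x = 0.
Proof.
move=> x1 x2 cx1; set y := x / 2.
have xE : x = y *+ 2 by rewrite /y -mulr_natr; field.
have sy0 : sin y = 0.
  have := cos2Dsin2 y; move: cx1; rewrite xE cos_mulr2n => c1 c2.
  apply/eqP; rewrite -sqrf_eq0; apply/eqP.
  by move: c1 c2; rewrite mulr2n; lra.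
suff -> : x = y *+ 2 by case: (ltrgt0P y) => [y0|y0|->]; rewrite ?mul0rn//;
  exfalso; [have := @sin_gt0_pi R y|have := @sin_gt0_pi R (- y)];
  rewrite ?sinN sy0 ?oppr0 ltxx => /(_ _) H; apply/notF/H; apply/andP; split;
  move: x1 x2; rewrite xE mulr2n; lra.
exact: xE.
Qed.

Lemma gdN x : gd (- x) = - gd x.
Proof.
have p0 := pi_gt0 R.
have [h1 h2 h3 h4] := And4 (gd_gt x) (gd_lt x) (gd_gt (- x)) (gd_lt (- x)).
apply/eqP; rewrite -addr_eq0; apply/eqP; apply: cos_eq1_small; try lra.
have ch : cosh (- x) = cosh x by rewrite /cosh opprK addrC.
have sh : sinh (- x) = - sinh x by rewrite /sinh opprK; field.
have c0 := cosh_gt0 x.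
have cE := cos_gd x; have sE := sin_gd x.
have := cos_gd (- x); have := sin_gd (- x); rewrite ch sh => sN cN.
apply: (mulIf (lt0r_neq0 c0)); apply: (mulIf (lt0r_neq0 c0)).
rewrite cosD.
transitivity ((cos (gd (- x)) * cosh x) * (cos (gd x) * cosh x) -
  (sin (gd (- x)) * cosh x) * (sin (gd x) * cosh x)); first by ring.
by rewrite cN cE sE sN; have := cosh2Bsinh2 x; nra.
Qed.

(* Rotation by [gd (a - b)] takes [sinh b - i cosh a] to [sinh a - i cosh b]. *)
Lemma gd_rotation_re a b :
  cos (gd (a - b)) * sinh b + sin (gd (a - b)) * cosh a = sinh a.
Proof.
apply: (mulIf (lt0r_neq0 (cosh_gt0 (a - b)))).
transitivity (cos (gd (a - b)) * cosh (a - b) * sinh b +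
  sin (gd (a - b)) * cosh (a - b) * cosh a); first by ring.
rewrite cos_gd sin_gd sinhB coshB.
have : (cosh a ^+ 2 - sinh a ^+ 2) * sinh b = sinh b.
  by rewrite cosh2Bsinh2 mul1r.
lra.
Qed.

Lemma gd_rotation_im a b :
  cos (gd (a - b)) * cosh a - sin (gd (a - b)) * sinh b = cosh b.
Proof.
apply: (mulIf (lt0r_neq0 (cosh_gt0 (a - b)))).
transitivity (cos (gd (a - b)) * cosh (a - b) * cosh a -
  sin (gd (a - b)) * cosh (a - b) * sinh b); first by ring.
rewrite cos_gd sin_gd sinhB coshB.
have : (cosh b ^+ 2 - sinh b ^+ 2) * cosh a = cosh a.
  by rewrite cosh2Bsinh2 mul1r.
lra.
Qed.

(** The two arctangents are the arguments of [cosh b + i sinh a] and [cosh a + i sinh b], which have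
    equal modulus and, by the rotation identities, differ by a rotation through [gd (a - b)]. *)
Lemma atan_sinh_cosh a b :
  atan (sinh a / cosh b) - atan (sinh b / cosh a) = gd (a - b).
Proof.
have p0 := pi_gt0 R.
have ca0 := lt0r_neq0 (cosh_gt0 a); have cb0 := lt0r_neq0 (cosh_gt0 b).
set X := atan _; set Y := atan _.
(* Polar coordinates: [k] is the inverse modulus of [cosh y + i sinh x]. *)
have polarE x y : let Z := atan (sinh x / cosh y) in
    exists2 k : R, 0 < k & [/\ cos Z = k * cosh y, sin Z = k * sinh x
                         & k ^+ 2 * (cosh y ^+ 2 + sinh x ^+ 2) = 1].
  move=> Z; have cy := cosh_gt0 y; have cy0 := lt0r_neq0 cy.
  exists (cos Z / cosh y); first by rewrite divr_gt0// cos_atan_gt0.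
  have sE : sin Z = cos Z / cosh y * sinh x by rewrite sin_atan; field.
  split=> //; first by field.
  by rewrite -(cos2Dsin2 Z) sE; field.
have [k k0 [cX sX kE]] := polarE a b; have [m m0 [cY sY mE]] := polarE b a.
have km : k = m.
  have N0 : cosh b ^+ 2 + sinh a ^+ 2 != 0.
    by apply/eqP => N0; move: kE; rewrite N0 mulr0 => /esym/eqP; rewrite oner_eq0.
  have NE : cosh a ^+ 2 + sinh b ^+ 2 = cosh b ^+ 2 + sinh a ^+ 2.
    by have := cosh2Bsinh2 a; have := cosh2Bsinh2 b; lra.
  move: mE; rewrite NE -kE => /(mulIf N0)/eqP.
  by rewrite eqrXn2 ?ltW// => /eqP.
have [h1 h2] := (gd_gt (a - b), gd_lt (a - b)).
have [X1 X2] := (atan_gtNpi2 (sinh a / cosh b), atan_ltpi2 (sinh a / cosh b)).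
have [Y1 Y2] := (atan_gtNpi2 (sinh b / cosh a), atan_ltpi2 (sinh b / cosh a)).
rewrite -/X -/Y in X1 X2 Y1 Y2.
apply/eqP; rewrite -subr_eq0; apply/eqP; apply: cos_eq1_small; try lra.
rewrite (cosB (X - Y)) (cosB X) (sinB X) cX sX cY sY km -[RHS]mE.
have re := gd_rotation_re a b; have im := gd_rotation_im a b.
transitivity (m ^+ 2 * (
  cosh b * (cos (gd (a - b)) * cosh a - sin (gd (a - b)) * sinh b) +
  sinh a * (cos (gd (a - b)) * sinh b + sin (gd (a - b)) * cosh a))).
  by ring.
rewrite re im.
by have := cosh2Bsinh2 a; have := cosh2Bsinh2 b; move=> ? ?; congr (_ * _); lra.
Qed.

End Gudermannian.

Lemma lattice_eqE (u v : lattice_point) :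
  (u == v) = (u.1 == v.1) && (u.2 == v.2).
Proof. by case: u v => [a b] [c d]. Qed.

Ltac lattice := apply/eqP; rewrite lattice_eqE /=; lia.

(** * Integration over simply connected square complexes *)

Section Cocycle.
Variables (E : rel lattice_point) (F : pred lattice_point) (A : zmodType).
Variable c : lattice_point -> lattice_point -> A.
Hypothesis c_anti : forall x y, c y x = - c x y.
Hypothesis c_face : forall q, F q ->
  c q (q + e1) + c (q + e1) (q + e1 + e2) =
  c q (q + e2) + c (q + e2) (q + e1 + e2).

(** The integral of the 1-cochain [c] along a vertex path. *)
Fixpoint chain_sum (s : seq lattice_point) : A :=
  if s is x :: s' then (if s' is y :: _ then c x y else 0) + chain_sum s' else 0.

Lemma chain_sum_cat a x b :
  chain_sum (a ++ x :: b) = chain_sum (rcons a x) + chain_sum (x :: b).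
Proof.
elim: a => [|y a IH]; first by rewrite /= addr0 add0r.
case: a IH => [|z a] IH; first by rewrite /= !addr0.
by rewrite /= in IH *; rewrite IH addrA.
Qed.

Lemma chain_sum_cat2 a x y b : chain_sum (rcons a x ++ y :: b) =
  chain_sum (rcons a x) + c x y + chain_sum (y :: b).
Proof. by rewrite cat_rcons (chain_sum_cat a x) /= addrA. Qed.

Lemma chain_sum_rev s : chain_sum (rev s) = - chain_sum s.
Proof.
elim: s => [|x s IH]; first by rewrite oppr0.
rewrite rev_cons; case: s IH => [|y s] IH; first by rewrite /= !addr0 oppr0.
rewrite rev_cons in IH *; rewrite -cats1 cat_rcons chain_sum_cat IH.
rewrite (_ : chain_sum (_ :: y :: s) = c x y + chain_sum (y :: s))//.
by rewrite [RHS]opprD -c_anti addrC /= !addr0.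
Qed.

(** A spur contributes [c x y + c y x = 0]. A face move is [c_face] read from any of the four
    corners; rotations by 4 or more leave the cycle unchanged. *)
Lemma homotopic_chain_sum s t : homotopic E F s t -> chain_sum s = chain_sum t.
Proof.
elim=> // [? ? ? _ -> _ -> //|a b x y _|a b q k x y z w Fq].
  rewrite (chain_sum_cat a x [:: y, x & b]) (chain_sum_cat a x b).
  by congr (_ + _); rewrite /= [c y x]c_anti addNKr.
move=> rotE; rewrite (chain_sum_cat a x [:: y, z & b]).
rewrite (chain_sum_cat a x [:: w, z & b]); congr (_ + _).
suff h : c x y + c y z = c x w + c w z by rewrite /= addrA h -addrA.
move: (c_face Fq) rotE; rewrite /corners.
move: (q + e1 + e2) => q3; move: (q + e1) (q + e2) => q2 q4 h.
case: k => [|[|[|[|k]]]].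
- by case=> <- <- <- <-.
- case=> <- <- <- <-; rewrite [c q2 q]c_anti [c q3 q4]c_anti.
  by apply/eqP; rewrite subr_eq -addrA -h addKr.
- case=> <- <- <- <-; rewrite ![c q3 _]c_anti ![c _ q]c_anti -!opprD.
  by rewrite addrC -h addrC.
- case=> <- <- <- <-; rewrite [c q4 q]c_anti [c q3 q2]c_anti.
  by apply/eqP; rewrite eq_sym subr_eq -addrA h addKr.
- by rewrite rot_oversize// => -[<- <- <- <-].
Qed.

(** Integrate [c] along a chosen path from a base point. For an edge from [x] to [y], the path to
    [x], the edge and the reversed path to [y] form a contractible loop, whose integral is 0. *)
Lemma simply_connected_integral V : symmetric E -> simply_connected V E F ->
  exists f : lattice_point -> A,
    forall x y, x \in V -> y \in V -> E x y -> f y = f x + c x y.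
Proof.
move=> Esym [/fset0Pn[x0 x0V] conn contr].
have /choice[p pP] y : exists p, y \in V -> path E x0 p /\ last x0 p = y.
  have [yV|_] := boolP (y \in V); last by exists [::].
  by have [p] := conn _ _ x0V yV; exists p.
exists (fun y => chain_sum (x0 :: p y)) => x y xV yV Exy.
have [px lx] := pP _ xV; have [py ly] := pP _ yV.
have revE : y :: rev (belast x0 (p y)) = rev (x0 :: p y).
  by rewrite [x0 :: p y]lastI rev_rcons ly.
have /homotopic_chain_sum :
    homotopic E F (x0 :: p x ++ y :: rev (belast x0 (p y))) [:: x0].
  apply: contr => //; last first.
    rewrite last_cat /=; case: (p y) ly => [<-//|z s _] /=.
    by rewrite rev_cons last_rcons.
  rewrite cat_path px lx /= Exy /= -{1}ly rev_path.
  by apply: sub_path py => u v; rewrite Esym.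
rewrite -cat_cons [x0 :: p x]lastI chain_sum_cat2 -lastI revE chain_sum_rev lx.
by rewrite [chain_sum [:: x0]]/= addr0 => /eqP; rewrite subr_eq0 => /eqP.
Qed.
End Cocycle.

(** * Local structure of a square complex *)

Section Lattice.
Variable G : {fset lattice_point}.
Implicit Types (v w q : lattice_point).

Lemma edges_ind (Q : lattice_point -> lattice_point -> Prop) :
  (forall q, q \in G -> [/\ Q q (q + e1), Q (q + e2) (q + e1 + e2),
                            Q q (q + e2) & Q (q + e1) (q + e1 + e2)]) ->
  forall v w, (v, w) \in edges G -> Q v w.
Proof.
move=> H v w; rewrite !inE => /flatten_mapP[q /H[? h ? ?]].
by rewrite !inE !xpair_eqE => /or4P[] /andP[/eqP-> /eqP->] //; rewrite addrAC.
Qed.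

Lemma mem_edges q : q \in G ->
  [/\ (q, q + e1) \in edges G, (q + e2, q + e1 + e2) \in edges G,
      (q, q + e2) \in edges G & (q + e1, q + e1 + e2) \in edges G].
Proof.
move=> qG; rewrite !inE; split; apply/flatten_mapP; exists q => //;
  by rewrite !inE ?(addrAC q e1) eqxx ?orbT.
Qed.

Lemma edges_step v w : (v, w) \in edges G -> w = v + e1 \/ w = v + e2.
Proof.
move: v w; apply: edges_ind => q _; split; [left|left|right|right] => //.
by rewrite addrAC.
Qed.

Lemma horizontal_edge v :
  ((v, v + e1) \in edges G) = (v \in G) || (v - e2 \in G).
Proof.
apply/idP/orP => [|[/mem_edges[]//|/mem_edges[_ + _ _]]]; last first.
  by rewrite (addrAC (v - e2)) subrK.
have : forall x y, (x, y) \in edges G -> y = x + e1 -> x \in G \/ x - e2 \in G.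
  apply: edges_ind => q qG; split; [by left|by right; rewrite addrK| |] => /eqP;
    by rewrite lattice_eqE /=; lia.
by move=> H /H; apply.
Qed.

Lemma vertical_edge v :
  ((v, v + e2) \in edges G) = (v \in G) || (v - e1 \in G).
Proof.
apply/idP/orP => [|[/mem_edges[]//|/mem_edges[_ _ _]]]; last first.
  by rewrite subrK.
have : forall x y, (x, y) \in edges G -> y = x + e2 -> x \in G \/ x - e1 \in G.
  apply: edges_ind => q qG; split; [| |by left|by right; rewrite addrK] => /eqP;
    by rewrite lattice_eqE /=; lia.
by move=> H /H; apply.
Qed.

Lemma adjacent_sym : symmetric (Defs.adjacent G).
Proof. by move=> v w; rewrite /Defs.adjacent /= orbC. Qed.

Lemma mem_corners q v : q \in G -> v \in corners q -> v \in vertices G.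
Proof. by move=> qG vq; rewrite !inE; apply/flatten_mapP; exists q. Qed.

Lemma verticesP v :
  reflect (exists2 q, q \in G & v \in corners q) (v \in vertices G).
Proof. by rewrite !inE; apply: flatten_mapP. Qed.

Lemma edges_vertices v w :
  (v, w) \in edges G -> v \in vertices G /\ w \in vertices G.
Proof.
move: v w; apply: edges_ind => q qG.
by split; split; apply: (mem_corners qG); rewrite !inE eqxx ?orbT.
Qed.

Lemma adjacent_vertices v w :
  Defs.adjacent G v w -> v \in vertices G /\ w \in vertices G.
Proof. by case/orP => /edges_vertices[]. Qed.

Lemma adjacent_step v w :
  Defs.adjacent G v w -> w \in [:: v + e1; v - e1; v + e2; v - e2].
Proof.
by rewrite !inE; case/orP => /edges_step[] ->; rewrite !lattice_eqE /=; lia.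
Qed.

Lemma mem_neighbors v w : (w \in neighbors G v) = Defs.adjacent G v w.
Proof.
rewrite !inE; apply/andP/idP => [[]//|vw]; split=> //.
by have [_] := adjacent_vertices vw; rewrite !inE.
Qed.

Lemma uniq_steps v : uniq [:: v + e1; v - e1; v + e2; v - e2].
Proof. by rewrite /= !inE !lattice_eqE /=; lia. Qed.

Lemma neighbors_sub v : {subset neighbors G v <= [:: v + e1; v - e1; v + e2; v - e2]}.
Proof. by move=> w; rewrite mem_neighbors; apply: adjacent_step. Qed.

Lemma neighbors_card v : (#|` neighbors G v| <= 4)%N.
Proof. exact: (uniq_leq_size (fset_uniq _) (@neighbors_sub v)). Qed.

Lemma mem_boundary v : (v \in boundary_vertices G) =
  (v \in vertices G) && (#|` neighbors G v| < 4)%N.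
Proof. by rewrite !inE. Qed.

Lemma mem_interior v : (v \in interior_vertices G) =
  (v \in vertices G) && (#|` neighbors G v| == 4%N).
Proof. by rewrite !inE. Qed.

Lemma vertex_cases v : v \in vertices G ->
  v \in interior_vertices G \/ v \in boundary_vertices G.
Proof.
rewrite mem_boundary mem_interior => ->; have := neighbors_card v.
by rewrite leq_eqVlt => /orP[->|->]; [left|right].
Qed.

Lemma interior_neighbors v : v \in interior_vertices G ->
  perm_eq (neighbors G v) [:: v + e1; v - e1; v + e2; v - e2].
Proof.
rewrite mem_interior => /andP[_ /eqP c4].
apply: uniq_perm; rewrite ?uniq_steps//; last first.
  by apply: (uniq_min_size (fset_uniq _) (@neighbors_sub v) _).2; rewrite c4.
Qed.

Lemma sum_interior_neighbors (A : nmodType) (f : lattice_point -> A) v :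
  v \in interior_vertices G ->
  \sum_(w <- neighbors G v) f w = f (v + e1) + f (v - e1) + f (v + e2) + f (v - e2).
Proof.
move=> /interior_neighbors vG; rewrite (perm_big _ vG) /= !big_cons big_nil.
by rewrite addr0 !addrA.
Qed.

Lemma interior_adjacent v w : v \in interior_vertices G ->
  Defs.adjacent G v w = (w \in [:: v + e1; v - e1; v + e2; v - e2]).
Proof. by move=> /interior_neighbors/perm_mem <-; rewrite mem_neighbors. Qed.

Lemma full_vertex_interior v : v \in G -> v - e1 \in G -> v - e2 \in G ->
  v - e1 - e2 \in G -> v \in interior_vertices G.
Proof.
move=> h1 h2 h3 h4; rewrite mem_interior.
have -> /= : v \in vertices G.
  by apply: (mem_corners h1); rewrite !inE eqxx.
rewrite eqn_leq neighbors_card /=.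
apply: (@uniq_leq_size _ [:: v + e1; v - e1; v + e2; v - e2]) (uniq_steps v) _.
move=> w; rewrite mem_neighbors !inE => /or4P[]/eqP->.
all: rewrite /Defs.adjacent/=.
- by rewrite horizontal_edge h1.
- by rewrite -{2 4}(subrK e1 v) horizontal_edge h2 orbT.
- by rewrite vertical_edge h1.
- by rewrite -{2 4}(subrK e2 v) vertical_edge h3 orbT.
Qed.

Lemma dual_adjacent_sym : symmetric (dual_adjacent G).
Proof.
suff H q q' : dual_adjacent G q q' -> dual_adjacent G q' q.
  by move=> q q'; apply/idP/idP; apply: H.
case/and4P => qG q'G qq' /hasP[s sq sq']; apply/and4P; split=> //.
  by rewrite eq_sym.
by apply/hasP; exists s.
Qed.

End Lattice.

(** * Integrating increments given on unit steps *)

Section StepIntegral.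
Variables (A : zmodType) (h k : lattice_point -> A).

(** Antisymmetric extension to all pairs of points of the increments [h] on horizontal and [k] on
    vertical steps. *)
Definition step_cocycle x y : A :=
  (if y == x + e1 then h x else 0) + (if y == x + e2 then k x else 0)
  - ((if x == y + e1 then h y else 0) + (if x == y + e2 then k y else 0)).

Lemma step_cocycle_e1 x : step_cocycle x (x + e1) = h x.
Proof.
rewrite /step_cocycle eqxx !ifF ?addr0 ?subr0//; apply/eqP => /eqP;
  rewrite lattice_eqE /=; lia.
Qed.

Lemma step_cocycle_e2 x : step_cocycle x (x + e2) = k x.
Proof.
rewrite /step_cocycle eqxx !ifF ?addr0 ?add0r ?subr0//; apply/eqP => /eqP;
  rewrite lattice_eqE /=; lia.
Qed.

Lemma step_integral V E (F : pred lattice_point) :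
  symmetric E -> simply_connected V E F ->
  (forall q, F q -> h q + k (q + e1) = k q + h (q + e2)) ->
  exists f : lattice_point -> A,
    (forall x, x \in V -> x + e1 \in V -> E x (x + e1) -> f (x + e1) = f x + h x) /\
    (forall x, x \in V -> x + e2 \in V -> E x (x + e2) -> f (x + e2) = f x + k x).
Proof.
move=> Esym sc hk.
have [] := @simply_connected_integral E F A step_cocycle _ _ V Esym sc.
- by move=> x y; rewrite /step_cocycle opprB.
- move=> q /hk; rewrite step_cocycle_e1 step_cocycle_e2 step_cocycle_e2 => ->.
  by rewrite (addrAC q) step_cocycle_e1.
- move=> f fE; exists f; split=> x xV yV xy; rewrite (fE _ _ xV yV xy).
    by rewrite step_cocycle_e1.
  by rewrite step_cocycle_e2.
Qed.
End StepIntegral.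

(** * Pinched vertices *)

Section Pinch.
Variable G : {fset lattice_point}.
Hypotheses (hG : complex_simply_connected G) (hGdual : dual_simply_connected G).
Implicit Types (v w q : lattice_point).

Lemma complex_step_integral (A : zmodType) (h k : lattice_point -> A) :
  (forall q, q \in G -> h q + k (q + e1) = k q + h (q + e2)) ->
  exists f : lattice_point -> A, forall q, q \in G ->
    [/\ f (q + e1) = f q + h q, f (q + e2) = f q + k q,
        f (q + e1 + e2) = f (q + e1) + k (q + e1)
      & f (q + e1 + e2) = f (q + e2) + h (q + e2)].
Proof.
move=> hk; have [f [fh fk]] := step_integral (@adjacent_sym G) hG hk.
have E x y : (x, y) \in edges G ->
    [/\ x \in vertices G, y \in vertices G & Defs.adjacent G x y].
  by move=> xy; have [? ?] := edges_vertices xy; rewrite /Defs.adjacent /= xy.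
exists f => q /mem_edges[/E[? ? ?] + /E[? ? ?] /E[? ? ?]].
rewrite (addrAC q) => /E[? ? ?].
by split; [exact: fh|exact: fk|rewrite addrAC; exact: fk|exact: fh].
Qed.

Lemma dual_connected_invariant (Q : lattice_point -> Prop) p :
  p \in G -> Q p -> (forall q q', dual_adjacent G q q' -> Q q -> Q q') ->
  forall q, q \in G -> Q q.
Proof.
move=> pG Qp step q qG; have [_ conn _] := hGdual.
have [s + <-] := conn _ _ pG qG.
by elim: s p {pG} Qp => //= q' s IH p Qp /andP[/step pq' /IH]; apply; apply: pq'.
Qed.

(* If the only edges of [G] on which [f] changes are sides of [p] at [v], then
   [f = f v + 1] on [p] propagates through the dual graph to every square, and
   no other square can contain [v]. *)
Lemma dual_separation (f : lattice_point -> int) v p p' :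
  p \in G -> p' \in G -> p' != p -> v \in corners p' ->
  (forall w, w \in corners p -> w != v -> f w = f v + 1) ->
  (forall q, q \in G -> q != p -> forall w, w \in corners q -> f w = f q) ->
  False.
Proof.
move=> pG p'G p'p vp' fp fconst.
have : forall w, w \in corners p' -> w != v -> f w = f v + 1.
  move: p' p'G {p'p vp'}; apply: (dual_connected_invariant pG) => //.
  move=> q q' /and4P[qG q'G _ /hasP[[x y] xyq xyq']] fq.
  have {}xyq' : (x, y) \in sides q' := xyq'.
  have [->//|q'p w wq' wv] := eqVneq q' p.
  have corner u : u \in sides q' -> u.1 \in corners q' /\ u.2 \in corners q'.
    case: u => a b; rewrite !inE !xpair_eqE (addrAC q' e1).
    by case/or4P => /andP[/eqP-> /eqP->]; rewrite !eqxx ?orbT.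
  have corner' u : u \in sides q -> u.1 \in corners q /\ u.2 \in corners q.
    case: u => a b; rewrite !inE !xpair_eqE (addrAC q e1).
    by case/or4P => /andP[/eqP-> /eqP->]; rewrite !eqxx ?orbT.
  have xy : x != y.
    apply: contraTneq xyq => ->; rewrite !inE !xpair_eqE !lattice_eqE /=; lia.
  have [xq yq] := corner' _ xyq; have [xq' yq'] := corner _ xyq'.
  rewrite (fconst _ q'G q'p _ wq').
  (* The shared edge has an end other than [v]; the value known there from [q] spreads over [q'],
     where [f] is constant. *)
  have [xv|xv] := eqVneq x v.
    by rewrite -(fconst _ q'G q'p _ yq') /= fq// -xv eq_sym.
  by rewrite -(fconst _ q'G q'p _ xq') /= fq.
have fc := fconst _ p'G p'p.
have [w wp' wv] : exists2 w, w \in corners p' & w != v.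
  have [vp|] := eqVneq v p'; last by exists p'; rewrite ?inE ?eqxx// eq_sym.
  by exists (p' + e1); rewrite ?inE ?eqxx ?orbT// vp lattice_eqE /=; lia.
move=> /(_ w wp' wv); rewrite (fc _ wp') (fc _ vp'); lia.
Qed.

(* Otherwise the cochain counting the steps from [v] into [v + e1] and [v + e2]
   is a cocycle, since the squares violating this are missing; integrate it. *)
Lemma no_pinch_diagonal v : v \in G -> v - e1 - e2 \in G ->
  v - e1 \in G \/ v - e2 \in G.
Proof.
move=> vG v3G; apply/orP/negPn/negP; rewrite negb_or => /andP[v2 v4].
pose h x : int := (x == v)%:Z.
have [q qG|f fE] := @complex_step_integral _ h h.
  have [->|qv] := eqVneq q v.
    by rewrite /h eqxx !lattice_eqE /=; lia.
  have q4 : q != v - e2 by apply: contraTneq qG => ->.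
  have q2 : q != v - e1 by apply: contraTneq qG => ->.
  by move: qv q2 q4; rewrite /h !lattice_eqE /=; lia.
apply: (@dual_separation f v v (v - e1 - e2)) => //.
- by rewrite lattice_eqE /=; lia.
- by rewrite !inE !lattice_eqE /=; lia.
- have [f1 f2 f3 _] := fE _ vG.
  move=> w; rewrite !inE => /or4P[]/eqP->; rewrite ?eqxx// => _;
  by move: f1 f2 f3; rewrite /h !lattice_eqE /=; lia.
- move=> q qG qv.
  have q4 : q != v - e2 by apply: contraTneq qG => ->.
  have q2 : q != v - e1 by apply: contraTneq qG => ->.
  have [f1 f2 f3 _] := fE _ qG.
  move=> w; rewrite !inE => /or4P[]/eqP-> //;
  by move: qv q2 q4 f1 f2 f3; rewrite /h !lattice_eqE /=; lia.
Qed.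

(** As in the diagonal case, with the cochain that is -1 on the step from [v - e1] to [v] and 1 on
    the step from [v] to [v + e2]. It fails to be closed only on the two missing squares. *)
Lemma no_pinch_antidiagonal v : v - e1 \in G -> v - e2 \in G ->
  v \in G \/ v - e1 - e2 \in G.
Proof.
move=> v2G v4G; apply/orP/negPn/negP; rewrite negb_or => /andP[v1 v3].
pose h x : int := - (x == v - e1)%:Z.
pose k x : int := (x == v)%:Z.
have [q qG|f fE] := @complex_step_integral _ h k.
  have [->|qv] := eqVneq q (v - e1).
    by rewrite /h /k eqxx !lattice_eqE /=; lia.
  have q1 : q != v by apply: contraTneq qG => ->.
  have q3 : q != v - e1 - e2 by apply: contraTneq qG => ->.
  by move: qv q1 q3; rewrite /h /k !lattice_eqE /=; lia.
apply: (@dual_separation f v (v - e1) (v - e2)) => //.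
- by rewrite lattice_eqE /=; lia.
- by rewrite !inE !lattice_eqE /=; lia.
- have [f1 f2 f3 _] := fE _ v2G; rewrite subrK in f1 f3.
  move=> w; rewrite !inE subrK => /or4P[]/eqP->; rewrite ?eqxx// => _;
  by move: f1 f2 f3; rewrite /h /k !lattice_eqE /=; lia.
- move=> q qG qv.
  have q1 : q != v by apply: contraTneq qG => ->.
  have q3 : q != v - e1 - e2 by apply: contraTneq qG => ->.
  have [f1 f2 f3 _] := fE _ qG.
  move=> w; rewrite !inE => /or4P[]/eqP-> //;
  by move: qv q1 q3 f1 f2 f3; rewrite /h /k !lattice_eqE /=; lia.
Qed.
End Pinch.

(** * Developing a ring pattern from its rho-radii *)

Section Rotation.
Variable R : realType.
Implicit Types (a b x y : R) (u : R * R).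

Definition rotate a u : R * R :=
  (cos a * u.1 - sin a * u.2, sin a * u.1 + cos a * u.2).

Lemma rotateD a u v : rotate a (u + v) = rotate a u + rotate a v.
Proof. by congr pair; rewrite /=; ring. Qed.

(** This makes the two squares along a horizontal edge assign the same vector to it; [rotate_gdN]
    does so for vertical edges. *)
Lemma rotate_gd l a x y :
  rotate (a + gd (x - y)) (l * sinh y, - (l * cosh x)) =
  rotate a (l * sinh x, - (l * cosh y)).
Proof.
have re := gd_rotation_re x y; have im := gd_rotation_im x y.
rewrite /rotate /= cosD sinD -re -im.
by congr pair; ring.
Qed.

Lemma rotate_gdN l a x y :
  rotate (a - gd (x - y)) (l * sinh y, l * cosh x) =
  rotate a (l * sinh x, l * cosh y).
Proof.
have re := gd_rotation_re x y; have im := gd_rotation_im x y.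
rewrite /rotate /= cosB sinB -re -im.
by congr pair; ring.
Qed.
End Rotation.

Section Developing.
Variables (R : realType) (G : {fset lattice_point}).
Hypotheses (hG : complex_simply_connected G) (hGdual : dual_simply_connected G).
Variables (l : R) (rho : lattice_point -> R).
Hypothesis flat : forall v, v \in interior_vertices G ->
  \sum_(w <- neighbors G v) gd (rho v - rho w) = 0.

(* [alpha q] is the direction from the center at [q] to the touching point of
   the square [q]. *)
Lemma square_directions : exists alpha : lattice_point -> R,
  (forall v, v \in G -> v - e2 \in G ->
    alpha (v - e2) = alpha v + gd (rho v - rho (v + e1))) /\
  (forall v, v \in G -> v - e1 \in G ->
    alpha (v - e1) = alpha v - gd (rho v - rho (v + e2))).
Proof.
(* The turns of the direction from [q] to [q + e1] and to [q + e2]. Closedness on the dual face [q]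
   is flatness at [q + e1 + e2]. *)
pose h q := gd (rho (q + e1) - rho (q + e1 + e2)).
pose k q := - gd (rho (q + e2) - rho (q + e2 + e1)).
have [q|f [fh fk]] := @step_integral _ h k G _ _ (@dual_adjacent_sym G) hGdual.
  move=> /allP qf; set v := q + e1 + e2.
  have v1 : v - e1 = q + e2 by rewrite /v; lattice.
  have v2 : v - e2 = q + e1 by rewrite /v; lattice.
  have v3 : v - e1 - e2 = q by rewrite /v; lattice.
  have vint : v \in interior_vertices G.
    by apply: full_vertex_interior; rewrite ?v3 ?v1 ?v2; apply: qf;
      rewrite !inE eqxx ?orbT.
  have := flat vint; rewrite sum_interior_neighbors// v1 v2.
  rewrite /h /k (addrAC q e2 e1) -/v -(opprB (rho v) (rho (q + e1))).
  by rewrite -(opprB (rho v) (rho (q + e2))) !gdN; lra.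
have adj1 q : q \in G -> q + e1 \in G -> dual_adjacent G q (q + e1).
  move=> qG q1G; apply/and4P; split=> //.
    by rewrite lattice_eqE /=; lia.
  apply/hasP; exists (q + e1, q + e1 + e2); first by rewrite !inE eqxx ?orbT.
  change ((q + e1, q + e1 + e2) \in sides (q + e1)).
  by rewrite !inE eqxx ?orbT.
have adj2 q : q \in G -> q + e2 \in G -> dual_adjacent G q (q + e2).
  move=> qG q1G; apply/and4P; split=> //.
    by rewrite lattice_eqE /=; lia.
  apply/hasP; exists (q + e2, q + e2 + e1); first by rewrite !inE eqxx ?orbT.
  change ((q + e2, q + e2 + e1) \in sides (q + e2)).
  by rewrite !inE eqxx ?orbT.
exists f; split=> v vG v'G.
- have := fk (v - e2) v'G; rewrite subrK => /(_ vG).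
  rewrite /k subrK => ->; first by rewrite subrK.
  by have := adj2 _ v'G; rewrite subrK; apply.
- have := fh (v - e1) v'G; rewrite subrK => /(_ vG).
  rewrite /h subrK => ->; first by rewrite addrK.
  by have := adj1 _ v'G; rewrite subrK; apply.
Qed.

Lemma developing_map : exists (alpha : lattice_point -> R)
    (z : lattice_point -> R * R),
  [/\ forall v, v \in G -> v - e2 \in G ->
        alpha (v - e2) = alpha v + gd (rho v - rho (v + e1)),
      forall v, v \in G -> v - e1 \in G ->
        alpha (v - e1) = alpha v - gd (rho v - rho (v + e2))
    & forall q, q \in G ->
      [/\ z (q + e1) = z q + rotate (alpha q)
            (l * sinh (rho q), - (l * cosh (rho (q + e1)))),
          z (q + e2) = z q + rotate (alpha q)
            (l * sinh (rho q), l * cosh (rho (q + e2)))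
        & z (q + e1 + e2) = z q + rotate (alpha q)
            (l * sinh (rho q) + l * sinh (rho (q + e1 + e2)), 0)]].
Proof.
have [alpha [alpha2 alpha1]] := square_directions.
(* The vector of the edge from [v] to [v + e1] is read off the square above it if present, else off
   the square below; [k] prefers the square on the right. By [top] and [right], both squares give
   the same vector. *)
pose h v :=
  if v \in G then
    rotate (alpha v) (l * sinh (rho v), - (l * cosh (rho (v + e1))))
  else rotate (alpha (v - e2)) (l * sinh (rho (v + e1)), - (l * cosh (rho v))).
pose k v :=
  if v \in G then
    rotate (alpha v) (l * sinh (rho v), l * cosh (rho (v + e2)))
  else rotate (alpha (v - e1)) (l * sinh (rho (v + e2)), l * cosh (rho v)).
have top q : q \in G -> h (q + e2) =
    rotate (alpha q) (l * sinh (rho (q + e1 + e2)), - (l * cosh (rho (q + e2)))).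
  move=> qG; rewrite /h addrK (addrAC q); case: ifPn => // q2G.
  by have := alpha2 _ q2G; rewrite addrK (addrAC q e2) => ->//; rewrite rotate_gd.
have right q : q \in G -> k (q + e1) =
    rotate (alpha q) (l * sinh (rho (q + e1 + e2)), l * cosh (rho (q + e1))).
  move=> qG; rewrite /k addrK; case: ifPn => // q2G.
  by have := alpha1 _ q2G; rewrite addrK => ->//; rewrite rotate_gdN.
have [q qG|z zE] := @complex_step_integral G hG _ h k.
  rewrite top// right// /h /k qG -!rotateD; congr rotate.
  by congr pair; rewrite /=; ring.
exists alpha, z; split=> // q qG; have [-> -> -> _] := zE q qG.
rewrite right// /h /k qG -addrA -rotateD; split=> //; congr (_ + rotate _ _).
by congr pair; rewrite /=; ring.
Qed.
End Developing.

(** * Kite angles, touching squares and directions around a vertex *)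

Section RingGeometry.
Variable R : realType.
Implicit Types (P : pattern R) (a x y : R) (z : R * R).

Lemma atanV x : 0 < x -> atan x^-1 = pi / 2 - atan x.
Proof.
move=> x0; have p0 := pi_gt0 R.
have [h1 h2] := (atan_ltpi2 x, atan_ltpi2 x^-1).
have h3 : 0 < atan x by rewrite -atan0 lt_atan.
have h4 : 0 < atan x^-1 by rewrite -atan0 lt_atan// invr_gt0.
have : atan x + atan x^-1 = pi / 2; last by lra.
apply: cos_inj; rewrite ?in_itv/=; [apply/andP; split; lra..|].
rewrite cos_pihalf cosD !sin_atan mulrACA divff ?gt_eqF//.
by rewrite mul1r subrr.
Qed.

(* The two summands of the angle are [sg x * (pi / 2) - atan (sinh x / cosh y)]
   and [atan (sinh y / cosh x)]. *)
Lemma kite_angleE (l x y : R) (C D : planar_ring R) : 0 < l ->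
  has_rho_radius l C x -> has_rho_radius l D y ->
  kite_angle C D = Num.sg x * (pi / 2) - gd (x - y).
Proof.
move=> l0 [oC iC] [oD iD]; rewrite /kite_angle iC iD oC oD -atan_sinh_cosh.
have lN0 : l != 0 by rewrite gt_eqF.
have [cx cy] := (cosh_gt0 x, cosh_gt0 y).
rewrite !(sgrM l) (gtr0_sg l0) !mul1r !(normrM l) (gtr0_norm l0).
rewrite -!(mulf_div l) divff// !mul1r.
have -> : Num.sg (sinh y) * atan (`|sinh y| / cosh x) = atan (sinh y / cosh x).
  case: (ltrgt0P (sinh y)) => [y0|y0|->].
  - by rewrite gtr0_sg// mul1r.
  - by rewrite ltr0_sg// (mulNr (sinh y)) atanN mulN1r opprK.
  - by rewrite sgr0 !mul0r atan0.
have -> : Num.sg (sinh x) * atan (cosh y / `|sinh x|) =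
    Num.sg (sinh x) * (pi / 2) - atan (sinh x / cosh y).
  case: (ltrgt0P (sinh x)) => [x0|x0|->].
  - by have := atanV (divr_gt0 x0 cy); rewrite invf_div gtr0_sg// => ->; ring.
  - have x1 : 0 < - sinh x by rewrite oppr_gt0.
    have := atanV (divr_gt0 x1 cy); rewrite invf_div ltr0_sg// => ->.
    by rewrite (mulNr (sinh x)) atanN; ring.
  - by rewrite sgr0 !mul0r atan0 subr0.
by rewrite sgr_sinh; ring.
Qed.

(** The centers at [q] and [q + e1 + e2] lie on the line of direction [a] through the touching
    point, the other two on its perpendicular there. Each condition is a polynomial identity modulo
    [c ^+ 2 + s ^+ 2 = 1]. *)
Lemma touching_square_rotate P q a z :
  let rA := inner (P q) in let RB := outer (P (q + e1)) in
  let rC := inner (P (q + e1 + e2)) in let RD := outer (P (q + e2)) in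
  0 < RB -> 0 < RD ->
  Defs.center (P q) = z -> Defs.center (P (q + e1)) = z + rotate a (rA, - RB) ->
  Defs.center (P (q + e1 + e2)) = z + rotate a (rA + rC, 0) ->
  Defs.center (P (q + e2)) = z + rotate a (rA, RD) ->
  touching_square P q (z + rotate a (rA, 0)).
Proof.
move=> rA RB rC RD RB0 RD0 zA zB zC zD; rewrite /touching_square.
rewrite zA zB zC zD -/rA -/RB -/rC -/RD.
rewrite /on_circle /sqdist /orient /rotate /=; have := cos2Dsin2 a.
move: (cos a) (sin a) => c s cs.
have h x y : x = y * (c ^+ 2 + s ^+ 2) -> x = y by rewrite cs mulr1.
have sg1 x y w : 0 < w -> x = w * y * (c ^+ 2 + s ^+ 2) -> Num.sg x = Num.sg y.
  by move=> w0 ->; rewrite cs mulr1 sgrM gtr0_sg// mul1r.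
split; [split| | |split].
1-6: by apply: h; ring.
- by apply: (sg1 _ _ RB) => //; ring.
- by apply: (sg1 _ _ RB) => //; ring.
- by apply: (sg1 _ _ RD) => //; ring.
- by apply: (sg1 _ _ RD) => //; ring.
Qed.

(* Directions of the four squares around a vertex, in cyclic order, can be
   chosen freely for missing squares as long as consecutive ones stay within
   [h]; only two opposite squares alone would be an obstruction. *)
Lemma fill_directions (h : R) (b1 b2 b3 b4 : bool) (x1 x2 x3 x4 : R) : 0 < h ->
  (b1 -> b2 -> -h < x1 - x2 < h) -> (b2 -> b3 -> - h < x2 - x3 < h) ->
  (b3 -> b4 -> -h < x3 - x4 < h) -> (b4 -> b1 -> - h < x4 - x1 < h) ->
  (b1 -> b3 -> b2 \/ b4) -> (b2 -> b4 -> b1 \/ b3) ->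
  exists y1 y2 y3 y4,
    [/\ b1 -> y1 = x1, b2 -> y2 = x2, b3 -> y3 = x3 & b4 -> y4 = x4] /\
    [/\ -h < y1 - y2 < h, -h < y2 - y3 < h, -h < y3 - y4 < h
      & -h < y4 - y1 < h].
Proof.
move=> h0.
(* A missing square gets the mean of its two neighbors, else its only neighbor, else the opposite
   direction. If both neighbors exist, so does the opposite square, hence they differ by less than
   [2h]. *)
pose f (p b n o : bool) (xp x xn xo : R) := if b then x else
  if p && n then (xp + xn) / 2 else if p then xp else if n then xn else
  if o then xo else 0.
move=> h1 h2 h3 h4 h5 h6.
exists (f b4 b1 b2 b3 x4 x1 x2 x3), (f b1 b2 b3 b4 x1 x2 x3 x4),
  (f b2 b3 b4 b1 x2 x3 x4 x1), (f b3 b4 b1 b2 x3 x4 x1 x2).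
split; first by rewrite /f; split=> ->.
rewrite {}/f; case: b1 b2 b3 b4 h1 h2 h3 h4 h5 h6 => [] [] [] [] /= h1 h2 h3 h4 h5 h6.
all: try by case: (h5 isT isT).
all: try by case: (h6 isT isT).
all: try have {h1}/andP[? ?] := h1 isT isT.
all: try have {h2}/andP[? ?] := h2 isT isT.
all: try have {h3}/andP[? ?] := h3 isT isT.
all: try have {h4}/andP[? ?] := h4 isT isT.
all: by split; apply/andP; split; lra.
Qed.

Lemma polarE z x a : polar z x a = z + rotate a (x, 0).
Proof. by case: z => u v; rewrite /polar /rotate /=; congr pair; rewrite /=; ring. Qed.

Lemma rotateDpihalf a x y : rotate (a + pi / 2) (x, y) = rotate a (- y, x).
Proof. by rewrite /rotate /= cosDpihalf sinDpihalf; congr pair; ring. Qed.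

Lemma rotateDpi a x y : rotate (a + pi) (x, y) = rotate a (- x, - y).
Proof. by rewrite /rotate /= cosDpi sinDpi; congr pair; ring. Qed.
End RingGeometry.

(** * The developed rings form a pattern *)

Section Construction.
Variables (R : realType) (G : {fset lattice_point}).
Hypotheses (hG : complex_simply_connected G) (hGdual : dual_simply_connected G).
Variables (l : R) (rho : lattice_point -> R).
Hypothesis l_gt0 : 0 < l.
Hypothesis flat : forall v, v \in interior_vertices G ->
  \sum_(w <- neighbors G v) gd (rho v - rho w) = 0.

Lemma ring_area_rho (C : planar_ring R) x :
  has_rho_radius l C x -> ring_area C = pi * l ^+ 2.
Proof.
move=> [oC iC]; rewrite /ring_area oC iC; congr (pi * _).
by rewrite !(exprMn _ l) -mulrBr cosh2Bsinh2 mulr1.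
Qed.

(** One orthogonality is Pythagoras; the other follows since equal areas make the two sums of
    squared radii equal. *)
Lemma orthogonal_rings_rho (C D : planar_ring R) x y a :
  has_rho_radius l C x -> has_rho_radius l D y ->
  Defs.center D = Defs.center C + rotate a (inner C, outer D) \/
  Defs.center D = Defs.center C + rotate a (inner C, - outer D) ->
  orthogonal_rings C D.
Proof.
move=> hC hD cD.
have A : outer C ^+ 2 - inner C ^+ 2 = outer D ^+ 2 - inner D ^+ 2.
  apply: (mulfI (lt0r_neq0 (pi_gt0 R))).
  by rewrite -!/(ring_area _) (ring_area_rho hC) (ring_area_rho hD).
have E : sqdist (Defs.center C) (Defs.center D) = inner C ^+ 2 + outer D ^+ 2.
  rewrite -[RHS]mulr1 -(cos2Dsin2 a).
  by case: cD => ->; rewrite /sqdist /rotate /=; ring.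
have E' : sqdist (Defs.center D) (Defs.center C) = inner C ^+ 2 + outer D ^+ 2.
  by rewrite -E /sqdist; ring.
by split; rewrite /orthogonal_circles ?E ?E'; lra.
Qed.

Lemma orthogonal_rings_sym (C D : planar_ring R) :
  orthogonal_rings C D -> orthogonal_rings D C.
Proof. by case. Qed.

Variables (alpha : lattice_point -> R) (z : lattice_point -> R * R).
Hypothesis alpha2 : forall v, v \in G -> v - e2 \in G ->
  alpha (v - e2) = alpha v + gd (rho v - rho (v + e1)).
Hypothesis alpha1 : forall v, v \in G -> v - e1 \in G ->
  alpha (v - e1) = alpha v - gd (rho v - rho (v + e2)).

Let P v := PlanarRing (z v) (l * sinh (rho v)) (l * cosh (rho v)).

Hypothesis develop : forall q, q \in G ->
  [/\ z (q + e1) = z q + rotate (alpha q) (inner (P q), - outer (P (q + e1))),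
      z (q + e2) = z q + rotate (alpha q) (inner (P q), outer (P (q + e2)))
    & z (q + e1 + e2) =
        z q + rotate (alpha q) (inner (P q) + inner (P (q + e1 + e2)), 0)].

Let t q := z q + rotate (alpha q) (inner (P q), 0).

Lemma outer_gt0 v : 0 < outer (P v).
Proof. by rewrite mulr_gt0// cosh_gt0. Qed.

Lemma rho_radiusP v : has_rho_radius l (P v) (rho v).
Proof. by []. Qed.

Lemma develop_orthogonal v w : Defs.adjacent G v w -> orthogonal_rings (P v) (P w).
Proof.
have H : forall v w, (v, w) \in edges G -> orthogonal_rings (P v) (P w).
  apply: edges_ind => q qG; have [z1 z2 z3] := develop qG; split.
  - by apply: (orthogonal_rings_rho (rho_radiusP _) (rho_radiusP _)); right; exact: z1.
  - apply: orthogonal_rings_sym.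
    (* Seen from the opposite corner [q + e1 + e2], the frame of the square is turned by pi. *)
    apply: (orthogonal_rings_rho (rho_radiusP _) (rho_radiusP _) (a := alpha q + pi)).
    right; rewrite [LHS]z2 [Defs.center _]z3 rotateDpi -(addrA (z _)) -rotateD.
    by congr (_ + rotate _ _); congr pair; rewrite /=; ring.
  - by apply: (orthogonal_rings_rho (rho_radiusP _) (rho_radiusP _)); left; exact: z2.
  - apply: orthogonal_rings_sym.
    apply: (orthogonal_rings_rho (rho_radiusP _) (rho_radiusP _) (a := alpha q + pi)).
    left; rewrite [LHS]z1 [Defs.center _]z3 rotateDpi -(addrA (z _)) -rotateD.
    by congr (_ + rotate _ _); congr pair; rewrite /=; ring.
by case/orP => [/H//|/H/orthogonal_rings_sym].
Qed.

Lemma develop_touching q : q \in G -> touching_square P q (t q).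
Proof.
move=> qG; have [z1 z2 z3] := develop qG.
by apply: touching_square_rotate => //; apply: outer_gt0.
Qed.

Lemma develop_directions v : exists y1 y2 y3 y4,
  [/\ v \in G -> y1 = alpha v, v - e1 \in G -> y2 = alpha (v - e1),
      v - e1 - e2 \in G -> y3 = alpha (v - e1 - e2)
    & v - e2 \in G -> y4 = alpha (v - e2)] /\
  [/\ - (pi / 2) < y1 - y2 < pi / 2, - (pi / 2) < y2 - y3 < pi / 2,
      - (pi / 2) < y3 - y4 < pi / 2 & - (pi / 2) < y4 - y1 < pi / 2].
Proof.
have p2 : 0 < pi / 2 :> R by have := pi_gt0 R; lra.
have gd1 x : - (pi / 2) < gd x < pi / 2 by rewrite gd_gt gd_lt.
have gd2 x : - (pi / 2) < - gd x < pi / 2 by rewrite -gdN.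
apply: fill_directions => //.
- by move=> h1 h2; rewrite (alpha1 h1 h2) opprB addrC subrK; exact: gd1.
- by move=> h1 h2; rewrite (alpha2 h1 h2) opprD addrA subrr sub0r; exact: gd2.
- move=> h1 h2; rewrite addrAC in h1 *.
  by rewrite (alpha1 h2 h1) addrAC subrr sub0r; exact: gd2.
- by move=> h1 h2; rewrite (alpha2 h2 h1) addrAC subrr add0r; exact: gd1.
- by move=> h1 h2; apply: no_pinch_diagonal.
- by move=> h1 h2; apply: no_pinch_antidiagonal.
Qed.

Lemma develop_ordered v : touching_points_ordered G P t v.
Proof.
have vE : v - e1 - e2 + e1 + e2 = v by lattice.
rewrite /touching_points_ordered /=; set r := l * sinh _; set Rad := l * cosh _ => r0.
have [y1 [y2 [y3 [y4 [[Y1 Y2 Y3 Y4] ys]]]]] := develop_directions v.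
have [/andP[? ?] /andP[? ?] /andP[? ?] /andP[? ?]] := ys.
have T1 : v \in G -> t v = z v + rotate y1 (r, 0) by move=> vG; rewrite Y1.
have T2 : v - e1 \in G -> t (v - e1) = z v + rotate y2 (0, Rad).
  move=> vG; have [+ _ _] := develop vG; rewrite /t subrK Y2// => ->.
  rewrite -(addrA (z _)) -rotateD; congr (_ + rotate _ _).
  by congr pair; rewrite /= /Rad; ring.
have T3 : v - e1 - e2 \in G -> t (v - e1 - e2) = z v + rotate y3 (- r, 0).
  move=> vG; have [_ _ +] := develop vG; rewrite /t vE Y3// => ->.
  rewrite -(addrA (z _)) -rotateD; congr (_ + rotate _ _).
  by congr pair; rewrite /= /r; ring.
have T4 : v - e2 \in G -> t (v - e2) = z v + rotate y4 (0, - Rad).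
  move=> vG; have [_ + _] := develop vG; rewrite /t subrK Y4// => ->.
  rewrite -(addrA (z _)) -rotateD; congr (_ + rotate _ _).
  by congr pair; rewrite /= /Rad; ring.
have := pi_gt0 R => p0.
case: (ltrgt0P r) r0 => // [r_gt0|r_lt0] _.
(* Consecutive [y]s differ by less than a quarter turn, so adding successive quarter turns makes the
   angles increase. *)
- exists (y4 - pi / 2), y1, (y2 + pi / 2), (y3 + pi).
  rewrite gtr0_sg// !mul1r; split; first by split; lra.
  split=> vG; rewrite polarE.
  + rewrite T4// -{1}(subrK (pi / 2) y4) rotateDpihalf; congr (_ + rotate _ _).
    by congr pair; ring.
  + by rewrite T1.
  + by rewrite T2// rotateDpihalf oppr0.
  + by rewrite T3// rotateDpi oppr0.
(* A negative inner radius reverses the directions of the inner touching points. Up to full turns,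
   the four directions now decrease, and negating them restores the order. *)
- exists (- (y4 + pi / 2 + pi)), (- (y1 + pi)), (- (y2 + pi / 2)), (- y3).
  rewrite ltr0_sg// !mulN1r !opprK; split; first by split; lra.
  split=> vG; rewrite polarE.
  + by rewrite T4// rotateDpi rotateDpihalf !oppr0.
  + by rewrite T1// rotateDpi opprK oppr0.
  + by rewrite T2// rotateDpihalf oppr0.
  + by rewrite T3.
Qed.

Lemma develop_cone_angle v : v \in interior_vertices G ->
  cone_angle G P v = 2 * pi * Num.sg (inner (P v)).
Proof.
move=> vi; rewrite /cone_angle.
under eq_bigr do rewrite (kite_angleE l_gt0 (rho_radiusP _) (rho_radiusP _)).
rewrite sumrB flat// subr0 sum_interior_neighbors//= (sgrM l) (gtr0_sg l_gt0) sgr_sinh.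
by field.
Qed.

End Construction.

Section Existence.
Variables (R : realType) (G : {fset lattice_point}).
Hypotheses (hG : complex_simply_connected G) (hGdual : dual_simply_connected G).

Lemma ring_pattern_of_rho (l : R) (rho : lattice_point -> R) : 0 < l ->
  (forall v, v \in interior_vertices G ->
    \sum_(w <- neighbors G v) gd (rho v - rho w) = 0) ->
  exists P : pattern R, [/\ ring_pattern G P, has_area G P (pi * l ^+ 2)
                          & forall v, has_rho_radius l (P v) (rho v)].
Proof.
move=> l0 flat.
have [alpha [z [alpha2 alpha1 dev]]] := developing_map hG hGdual l flat.
exists (fun v => PlanarRing (z v) (l * sinh (rho v)) (l * cosh (rho v))).
split=> //; last by move=> v _; apply: (ring_area_rho (x := rho v)).
split.
- by move=> v _; exact: (outer_gt0 _ l0 z v).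
- by move=> v w vw; apply: (develop_orthogonal dev).
- exists (fun q => z q + rotate (alpha q) (l * sinh (rho q), 0)); split=> v vG.
    exact: (develop_touching l0 dev vG).
  exact: (develop_ordered hG hGdual l0 alpha2 alpha1 dev).
- by move=> v vi; apply: develop_cone_angle.
Qed.
End Existence.

(** * Rigidity *)

Section Rigidity.
Variable R : realType.
Implicit Types (P Q : pattern R) (c s r x y : R) (b p q : plane R).

Lemma sum_sqr_eq0 x y : x ^+ 2 + y ^+ 2 = 0 -> x = 0 /\ y = 0.
Proof.
move=> /eqP; rewrite paddr_eq0 ?sqr_ge0// !sqrf_eq0.
by case/andP => /eqP-> /eqP->.
Qed.

(** Equality case of the Cauchy-Schwarz inequality. *)
Lemma eq_of_dot x y c s r : x ^+ 2 + y ^+ 2 = r ^+ 2 -> c ^+ 2 + s ^+ 2 = 1 ->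
  x * c + y * s = r -> x = r * c /\ y = r * s.
Proof.
move=> xy cs d; have [|h1 h2] := @sum_sqr_eq0 (x - r * c) (y - r * s).
  transitivity (x ^+ 2 + y ^+ 2 - 2 * r * (x * c + y * s) + r ^+ 2 * (c ^+ 2 + s ^+ 2)).
    by ring.
  by rewrite xy cs d; ring.
by split; lra.
Qed.

(* Up to a motion, a square is determined by the radii of its rings: with
   [u] the direction from [A] to the touching point [t] and [u'] its rotation
   by a right angle, [t - A = rA u], [C - t = rC u], [t - B = RB u'] and
   [D - t = RD u']. *)
Lemma touching_square_motion P v t :
  touching_square P v t -> orthogonal_rings (P v) (P (v + e1)) ->
  0 < inner (P v) -> 0 < inner (P (v + e1 + e2)) ->
  0 < outer (P (v + e1)) -> 0 < outer (P (v + e2)) ->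
  exists c s, c ^+ 2 + s ^+ 2 = 1 /\
    let z := Defs.center (P v) in let rA := inner (P v) in
  [/\ z = motion c s z (0, 0),
      Defs.center (P (v + e1)) = motion c s z (rA, - outer (P (v + e1))),
      Defs.center (P (v + e1 + e2)) = motion c s z (rA + inner (P (v + e1 + e2)), 0)
    & Defs.center (P (v + e2)) = motion c s z (rA, outer (P (v + e2)))].
Proof.
rewrite /touching_square /orthogonal_rings /orthogonal_circles /on_circle.
case: (P v) (P (v + e1)) (P (v + e1 + e2)) (P (v + e2)) =>
  [[a1 a2] rA RA] [[b1 b2] rB RB] [[c1 c2] rC RC] [[d1 d2] rD RD] /=.
case: t => t1 t2; rewrite /sqdist /orient /motion /=.
move=> [[tA tC tB tD] AC BD [sAB _ _ _]] [_ AB] rA0 rC0 RB0 RD0.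
have {sAB} oAB : 0 < (b1 - a1) * (t2 - a2) - (b2 - a2) * (t1 - a1).
  by rewrite -sgr_cp0 sAB gtr0_sg.
have rAN := lt0r_neq0 rA0.
pose c := (t1 - a1) / rA; pose s := (t2 - a2) / rA.
have tc : t1 - a1 = rA * c by rewrite /c; field.
have ts : t2 - a2 = rA * s by rewrite /s; field.
have cs : c ^+ 2 + s ^+ 2 = 1.
  apply: (mulfI (expf_neq0 2 rAN)); rewrite mulr1 mulrDr -!exprMn -tc -ts -tA.
  by ring.
have [tE1 tE2] : t1 = a1 + rA * c /\ t2 = a2 + rA * s by split; lra.
clearbody c s; subst t1 t2; clear tA tc ts.
have cs' : (- s) ^+ 2 + c ^+ 2 = 1 by rewrite sqrrN addrC.
have csA : rA ^+ 2 * (c ^+ 2 + s ^+ 2) = rA ^+ 2 by rewrite cs mulr1.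
have csB : RB ^+ 2 * ((- s) ^+ 2 + c ^+ 2) = RB ^+ 2 by rewrite cs' mulr1.
(* The distance [rA + rC] of the inner centers forces [C - t] to be parallel to [t - A]. *)
have [C1 C2] : c1 - (a1 + rA * c) = rC * c /\ c2 - (a2 + rA * s) = rC * s.
  by apply: eq_of_dot => //; apply: (mulfI rAN); lra.
(* Orthogonality along the side AB makes [t - B] perpendicular to [t - A]; the orientation condition
   selects its sign. *)
have [B1 B2] : a1 + rA * c - b1 = RB * - s /\ a2 + rA * s - b2 = RB * c.
  have tB' : (a1 + rA * c - b1) ^+ 2 + (a2 + rA * s - b2) ^+ 2 = RB ^+ 2.
    by rewrite -tB; ring.
  apply: eq_of_dot => //.
  have p0 : (a1 + rA * c - b1) * c + (a2 + rA * s - b2) * s = 0.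
    by apply: (mulfI rAN); lra.
  set d := (X in X = _).
  have d0 : 0 < d by rewrite -(pmulr_rgt0 _ rA0) /d; lra.
  have : d ^+ 2 = RB ^+ 2.
    rewrite -[RHS]mulr1 -cs -tB'.
    transitivity (d ^+ 2 + ((a1 + rA * c - b1) * c + (a2 + rA * s - b2) * s) ^+ 2).
      by rewrite p0; ring.
    by rewrite /d; ring.
  by move/eqP; rewrite eqrXn2 ?ltW// => /eqP.
have [D1 D2] : d1 - (a1 + rA * c) = RD * - s /\ d2 - (a2 + rA * s) = RD * c.
  apply: eq_of_dot => //; apply: (mulfI (lt0r_neq0 RB0)).
  have b1E : b1 = a1 + rA * c - RB * - s by lra.
  have b2E : b2 = a2 + rA * s - RB * c by lra.
  by subst b1 b2; lra.
exists c, s; split=> //; split; congr pair; lra.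
Qed.

(** The difference of the rotation parts is multiplication by a complex number that annihilates
    [p - q]. *)
Lemma motion_inj c s b c' s' b' p q :
  motion c s b p = motion c' s' b' p -> motion c s b q = motion c' s' b' q ->
  sqdist p q != 0 -> [/\ c = c', s = s' & b = b'].
Proof.
case: p q b b' => [p1 p2] [q1 q2] [b1 b2] [b1' b2'].
rewrite /motion /sqdist /= => -[h1 h2] [h3 h4] pq0.
have k1 : (c - c') * (p1 - q1) - (s - s') * (p2 - q2) = 0 by lra.
have k2 : (s - s') * (p1 - q1) + (c - c') * (p2 - q2) = 0 by lra.
have : (c - c') ^+ 2 + (s - s') ^+ 2 = 0.
  apply: (mulIf pq0); rewrite mul0r.
  transitivity (((c - c') * (p1 - q1) - (s - s') * (p2 - q2)) ^+ 2 +
    ((s - s') * (p1 - q1) + (c - c') * (p2 - q2)) ^+ 2); first by ring.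
  by rewrite k1 k2; ring.
move=> /sum_sqr_eq0[e1 e2].
have ec : c' = c by lra.
have es : s' = s by lra.
by subst c' s'; split=> //; congr pair; lra.
Qed.

Lemma motion_change c s z c' s' z' : c ^+ 2 + s ^+ 2 = 1 -> c' ^+ 2 + s' ^+ 2 = 1 ->
  exists c0 s0 b, c0 ^+ 2 + s0 ^+ 2 = 1 /\
    forall p : plane R, motion c' s' z' p = motion c0 s0 b (motion c s z p).
Proof.
(* As complex numbers, [c0 + i s0] is the quotient of [c' + i s'] by [c + i s]. *)
move=> cs cs'; pose c0 := c' * c + s' * s; pose s0 := s' * c - c' * s.
exists c0, s0, (z'.1 - c0 * z.1 + s0 * z.2, z'.2 - s0 * z.1 - c0 * z.2); split.
  transitivity ((c ^+ 2 + s ^+ 2) * (c' ^+ 2 + s' ^+ 2)); first by rewrite /c0 /s0; ring.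
  by rewrite cs cs' mulr1.
have cE : c' = c0 * c - s0 * s.
  by rewrite -[LHS]mulr1 -cs /c0 /s0; ring.
have sE : s' = s0 * c + c0 * s.
  by rewrite -[LHS]mulr1 -cs /c0 /s0; ring.
move=> p; clearbody c0 s0; rewrite cE sE /motion /=.
by congr pair; ring.
Qed.

End Rigidity.

Section Congruence.
Variables (R : realType) (G : {fset lattice_point}) (P Q : pattern R).
Hypothesis hGdual : dual_simply_connected G.
Hypotheses (hP : ring_pattern G P) (hQ : ring_pattern G Q).
Hypothesis radii : forall v, v \in vertices G ->
  ((inner (Q v) = inner (P v)) * (outer (Q v) = outer (P v)))%type.
Hypothesis inner_gt0 : forall v, v \in vertices G -> 0 < inner (P v).

Lemma square_motion q : q \in G -> exists c s b, c ^+ 2 + s ^+ 2 = 1 /\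
  forall v, v \in corners q -> Defs.center (Q v) = motion c s b (Defs.center (P v)).
Proof.
move=> qG; have vq v : v \in corners q -> v \in vertices G by apply: mem_corners.
have /vq vA : q \in corners q by rewrite !inE eqxx.
have /vq vB : q + e1 \in corners q by rewrite !inE eqxx ?orbT.
have /vq vC : q + e1 + e2 \in corners q by rewrite !inE eqxx ?orbT.
have /vq vD : q + e2 \in corners q by rewrite !inE eqxx ?orbT.
have adj : Defs.adjacent G q (q + e1).
  by apply/orP; left; have [] := mem_edges qG.
have [oP rP [tP [/(_ _ qG) sP _]] _] := hP.
have [oQ rQ [tQ [/(_ _ qG) sQ _]] _] := hQ.
have [c [s [cs [zA zB zC zD]]]] := touching_square_motion sP (rP _ _ adj)
  (inner_gt0 vA) (inner_gt0 vC) (oP _ vB) (oP _ vD).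
have [||||c' [s' [cs' [zA' zB' zC' zD']]]] := touching_square_motion sQ (rQ _ _ adj).
1-4: by rewrite ?(radii vA) ?(radii vC); auto.
have [c0 [s0 [b [cs0 mE]]]] :=
  motion_change (Defs.center (P q)) (Defs.center (Q q)) cs cs'.
exists c0, s0, b; split=> // v; rewrite !inE => /or4P[]/eqP->.
- by rewrite zA' zA mE.
- by rewrite zB' zB mE !(radii vA) !(radii vB).
- by rewrite zC' zC mE !(radii vA) !(radii vC).
- by rewrite zD' zD mE !(radii vA) !(radii vD).
Qed.

Lemma adjacent_sqdist_neq0 v w : Defs.adjacent G v w ->
  sqdist (Defs.center (P v)) (Defs.center (P w)) != 0.
Proof.
move=> vw; have [oP rP _ _] := hP; have [-> _] := rP _ _ vw.
have [/oP o0 _] := adjacent_vertices vw.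
by rewrite gt_eqF// ltr_wpDr ?sqr_ge0// exprn_gt0.
Qed.

Lemma congruent_of_radii : congruent G P Q.
Proof.
have [/fset0Pn[q0 q0G] _ _] := hGdual.
have [c [s [b [cs E]]]] := square_motion q0G.
suff H q : q \in G -> forall v, v \in corners q ->
    Defs.center (Q v) = motion c s b (Defs.center (P v)).
  exists c, s, b; split=> // v vG; have [rI rO] := radii vG; split=> //.
  by have /verticesP[q qG /H] := vG; apply.
move: q; apply: (dual_connected_invariant hGdual q0G) => //.
move=> q q' /and4P[qG q'G _ /hasP[[x y] xyq xyq']] Eq.
have {}xyq' : (x, y) \in sides q' := xyq'.
have xy : Defs.adjacent G x y.
  by apply/orP; left; rewrite !inE; apply/flatten_mapP; exists q.
have side p : (x, y) \in sides p -> x \in corners p /\ y \in corners p.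
  rewrite !inE !xpair_eqE (addrAC p e2 e1).
  by case/or4P => /andP[/eqP-> /eqP->]; rewrite !eqxx ?orbT.
have [xq yq] := side _ xyq; have [xq' yq'] := side _ xyq'.
have [c' [s' [b' [_ Eq']]]] := square_motion q'G.
have [] := @motion_inj R c s b c' s' b' (Defs.center (P x)) (Defs.center (P y)).
- by rewrite -Eq// -Eq'.
- by rewrite -Eq// -Eq'.
- exact: adjacent_sqdist_neq0.
by move=> -> -> ->.
Qed.
End Congruence.

(** * Solving the rho-equations *)

Section Perron.
Variable R : realType.

Lemma is_derive_gd (x : R) : is_derive x 1 (@gd R) (2 * ((1 + expR x ^+ 2)^-1 * expR x)).
Proof. by apply: is_derive_eq; rewrite subr0. Qed.

(** Mean value theorem: the derivative [2u / (1 + u^2)], with [u] an exponential, is at most 1. *)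
Lemma gd_lipschitz (x e : R) : 0 <= e -> gd (x + e) <= gd x + e.
Proof.
rewrite le_eqVlt => /predU1P[<-|e0]; first by rewrite !addr0.
have xe : x < x + e by rewrite ltrDl.
have [|c _ E] := MVT xe (fun z _ => is_derive_gd z).
  apply: derivable_within_continuous => z _.
  exact: (@ex_derive _ _ _ _ _ _ _ (is_derive_gd z)).
move: E; rewrite (_ : x + e - x = e) => [E|]; last by ring.
suff : 2 * ((1 + expR c ^+ 2)^-1 * expR c) * e <= e by lra.
apply: ler_piMl; first exact: ltW.
have h : 0 < 1 + expR c ^+ 2 by rewrite ltr_wpDr ?sqr_ge0.
rewrite mulrCA mulrC ler_pdivrMr// mul1r.
have := sqr_ge0 (1 - expR c); lra.
Qed.

Variables (T : eqType) (N : T -> seq T) (U : pred T) (K g : T -> R) (m M : R).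

Let F (rho : T -> R) v := \sum_(w <- N v) gd (rho v - rho w).

Let subsolution rho := (forall v, ~~ U v -> rho v = g v) /\
  forall v, U v -> rho v <= m \/ F rho v <= K v.

Lemma sum_gd_shift (s : seq T) (rho : T -> R) x K0 :
  \sum_(w <- s) gd (x - rho w) < K0 ->
  exists2 e, 0 < e & \sum_(w <- s) gd (x + e - rho w) < K0.
Proof.
(* One more than the number of summands, so that [n] is positive and the final inequality strict. *)
move=> lt; pose n : R := (size s).+1%:R; have n0 : 0 < n by rewrite ltr0n.
pose e := (K0 - \sum_(w <- s) gd (x - rho w)) / n.
have e0 : 0 < e by rewrite divr_gt0// subr_gt0.
exists e => //.
have : \sum_(w <- s) gd (x + e - rho w) <= \sum_(w <- s) (gd (x - rho w) + e).
  by apply: ler_sum => w _; rewrite addrAC gd_lipschitz// ltW.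
move/le_lt_trans; apply; rewrite big_split /= big_const_seq count_predT iter_addr_0.
have : K0 = \sum_(w <- s) gd (x - rho w) + e * n.
  by rewrite /e divfK ?gt_eqF// addrCA subrr addr0.
move=> ->; rewrite ltrD2l -mulr_natr ltr_pM2l// ltr_nat.
by [].
Qed.

Lemma sum_gd_shiftN (s : seq T) (rho : T -> R) x K0 :
  K0 < \sum_(w <- s) gd (x - rho w) ->
  exists2 e, 0 < e & K0 < \sum_(w <- s) gd (x - e - rho w).
Proof.
move=> lt; have [|e e0 h] := @sum_gd_shift s (fun w => - rho w) (- x) (- K0).
  rewrite ltrNr -sumrN; under eq_bigr do rewrite -gdN opprD !opprK.
  by [].
exists e => //; move: h; rewrite ltrNr -sumrN.
by under eq_bigr do rewrite -gdN !opprD !opprK.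
Qed.

Hypothesis bounded : forall rho, subsolution rho -> forall v, U v -> rho v <= M.

(* The supremum of the subsolutions, where the obstacle [m] makes their set
   nonempty; [bounded] is the only global input. *)
Lemma perron : exists rho, (forall v, ~~ U v -> rho v = g v) /\
  forall v, U v -> [/\ m <= rho v, K v <= F rho v & m < rho v -> F rho v <= K v].
Proof.
pose S v : set R := fun x => exists2 rho, subsolution rho & x = rho v.
pose top v := if U v then sup (S v) else g v.
pose bot v := if U v then m else g v.
have bot_sub : subsolution bot.
  by split=> v; rewrite /bot; [move/negbTE->|move=> ->; left].
have S_sup v : U v -> has_sup (S v).
  move=> vU; split; first by exists (bot v); exists bot.
  by exists M => _ [rho rs ->]; apply: bounded.
have le_top rho : subsolution rho -> forall v, rho v <= top v.
  move=> rs v; rewrite /top; case: ifPn => vU; last by rewrite rs.1.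
  by apply: ub_le_sup; [case: (S_sup v vU)|exists rho].
have top_out v : ~~ U v -> top v = g v by rewrite /top => /negbTE->.
have top_ge v : U v -> m <= top v.
  by move=> vU; have := le_top _ bot_sub v; rewrite /bot vU.
have top_le v : U v -> m < top v -> F top v <= K v.
  (* Otherwise a subsolution within [e'] of [top] at [v] would violate its inequality there, being
     at most [top] elsewhere; [e' <= top v - m] keeps it above the obstacle. *)
  move=> vU mv; rewrite leNgt; apply/negP => /sum_gd_shiftN[e e0 he].
  pose e' := Num.min e (top v - m).
  have e'0 : 0 < e' by rewrite lt_min e0 subr_gt0.
  have [_ [rho rs ->] rv] := sup_adherent e'0 (S_sup v vU).
  have {}rv : top v - e' < rho v by move: rv; rewrite /top vU.
  have : e' <= e /\ e' <= top v - m by rewrite !ge_min !lexx ?orbT.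
  move=> [e'e e'm].
  have [|rK] := rs.2 v vU; first by lra.
  move: he; apply/negP; rewrite -leNgt; apply: le_trans rK.
  by apply: ler_sum => w _; apply: ler_gd; have := le_top _ rs w; lra.
exists top; split=> // v vU; split; [exact: top_ge| |exact: top_le].
(* Otherwise raising [top] at [v] alone gives a subsolution exceeding the supremum. *)
rewrite leNgt; apply/negP => /sum_gd_shift[e e0 he].
pose up w := if w == v then top v + e else top w.
have up_ge w : top w <= up w by rewrite /up; case: eqP => [->|//]; lra.
have up_sub : subsolution up.
  split=> [w wU|w wU].
    rewrite /up ifN ?top_out//; apply: contraNneq wU => ->; exact: vU.
  have [wv|wv] := eqVneq w v.
    right; subst w; apply: le_trans (ltW he); apply: ler_sum => w _; apply: ler_gd.
    by rewrite {1}/up eqxx; have := up_ge w; lra.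
  have upw : up w = top w by rewrite /up (negbTE wv).
  have := top_ge w wU; rewrite le_eqVlt => /predU1P[mw|/(top_le w wU) h].
    by left; rewrite upw mw.
  right; apply: le_trans h; apply: ler_sum => u _; apply: ler_gd.
  by rewrite upw; have := up_ge u; lra.
by have := le_top _ up_sub v; rewrite /up eqxx; lra.
Qed.
End Perron.

(** * Maximum and comparison principles *)

Section Comparison.
Variables (R : realType) (G : {fset lattice_point}).

Lemma seq_argmax d (D : orderType d) (T : eqType) (s : seq T) (f : T -> D) x0 :
  x0 \in s -> exists2 x, x \in s & forall y, y \in s -> (f y <= f x)%O.
Proof.
elim: s x0 => // a [|b s] IH x0 _.
  by exists a; rewrite ?mem_head// => y; rewrite inE => /eqP->.
have [x xs xP] := IH b (mem_head _ _).
have [h|h] := leP (f a) (f x).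
  exists x; first by rewrite inE xs orbT.
  by move=> y; rewrite inE => /predU1P[->//|/xP].
exists a; first exact: mem_head.
by move=> y; rewrite inE => /predU1P[->//|/xP/le_trans]; apply; apply: ltW.
Qed.

Lemma max_on_boundary (d : lattice_point -> R) M :
  (forall v, v \in interior_vertices G -> M < d v ->
    (forall w, Defs.adjacent G v w -> d w <= d v) ->
    forall w, Defs.adjacent G v w -> d w = d v) ->
  (forall v, v \in boundary_vertices G -> d v <= M) ->
  forall v, v \in vertices G -> d v <= M.
Proof.
move=> int bnd v0 v0G; rewrite leNgt; apply/negP => Mv0.
(* Among the maximizers take a leftmost one: it has no left neighbor where [d]
   is maximal. *)
have [v1 v1G v1max] := seq_argmax d v0G.
have Mv1 : M < d v1 by apply: lt_le_trans Mv0 (v1max _ v0G).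
pose s := [seq v <- vertices G | d v == d v1].
have v1s : v1 \in s by rewrite mem_filter eqxx v1G.
have [v vs vmax] := seq_argmax (fun v : lattice_point => - v.1) v1s.
move: vs; rewrite mem_filter => /andP[/eqP dv vG].
have vi : v \in interior_vertices G.
  case: (vertex_cases vG) => // /bnd; rewrite dv leNgt Mv1//.
have adj : Defs.adjacent G v (v - e1).
  by rewrite interior_adjacent// !inE eqxx ?orbT.
have dv1 : d (v - e1) = d v.
  apply: int => //; first by rewrite dv.
  by move=> w /adjacent_vertices[_ /v1max]; rewrite dv.
have : v - e1 \in s.
  by rewrite mem_filter dv1 dv eqxx; have [_ ->] := adjacent_vertices adj.
by move/vmax => /=; lia.
Qed.

(** At an interior maximum of [rho - rho'] above [M], each summand for [rho] is at least that for
    [rho']. The assumed inequality forces equality in each, and strict monotonicity of [gd] passes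
    the maximum to all neighbors. *)
Lemma comparison (rho rho' : lattice_point -> R) M :
  (forall v, v \in interior_vertices G -> M < rho v - rho' v ->
    \sum_(w <- neighbors G v) gd (rho v - rho w) <=
    \sum_(w <- neighbors G v) gd (rho' v - rho' w)) ->
  (forall v, v \in boundary_vertices G -> rho v - rho' v <= M) ->
  forall v, v \in vertices G -> rho v - rho' v <= M.
Proof.
move=> int; apply: max_on_boundary => v vi Mv vmax w vw.
have := int v vi Mv; rewrite !sum_interior_neighbors//.
have ge u : Defs.adjacent G v u -> gd (rho' v - rho' u) <= gd (rho v - rho u).
  by move=> /vmax h; apply: ler_gd; lra.
have eq u : gd (rho' v - rho' u) = gd (rho v - rho u) ->
    rho u - rho' u = rho v - rho' v.
  move=> E; case: (ltrgtP (rho' v - rho' u) (rho v - rho u)) => [h|h|h];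
    [by have := ltr_gd h; rewrite E ltxx..|lra].
have adj u : u \in [:: v + e1; v - e1; v + e2; v - e2] -> Defs.adjacent G v u.
  by rewrite interior_adjacent.
have g1 := ge _ (adj (v + e1) _); have g2 := ge _ (adj (v - e1) _).
have g3 := ge _ (adj (v + e2) _); have g4 := ge _ (adj (v - e2) _).
move: g1 g2 g3 g4; rewrite !inE !eqxx ?orbT.
move=> /(_ isT) g1 /(_ isT) g2 /(_ isT) g3 /(_ isT) g4 h.
have := vw; rewrite interior_adjacent// !inE => /or4P[]/eqP->; apply: eq; lra.
Qed.
End Comparison.

(** * Rewriting sums over neighbors as sums over edges *)

Section EdgeSums.
Variables (G : {fset lattice_point}) (A : nmodType).
Implicit Type h : lattice_point -> lattice_point -> A.

Lemma edges_asym v w : (v, w) \in edges G -> (w, v) \notin edges G.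
Proof.
move=> /edges_step vw; apply/negP => /edges_step.
by case: vw => -> [] /eqP; rewrite lattice_eqE /=; lia.
Qed.

Lemma sum_neighbors_edges h :
  \sum_(v <- vertices G) \sum_(w <- neighbors G v) h v w =
  \sum_(e <- edges G) (h e.1 e.2 + h e.2 e.1).
Proof.
transitivity (\sum_(p <- [seq (v, w) | v <- vertices G, w <- neighbors G v]) h p.1 p.2).
  by rewrite big_allpairs_dep.
rewrite big_split /=.
rewrite -(big_map (fun e : lattice_point * lattice_point => (e.2, e.1)) xpredT
  (fun p => h p.1 p.2)).
rewrite -big_cat; apply: perm_big; apply: uniq_perm.
- apply: allpairs_uniq_dep; first exact: fset_uniq.
    by move=> v _; exact: fset_uniq.
  by move=> [a b] [c d] _ _ [/= -> ->].
- rewrite cat_uniq fset_uniq map_inj_uniq ?fset_uniq ?andbT//=; last first.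
    by move=> [a b] [c d] [-> ->].
  by apply/hasPn => _ /mapP[[a b] /edges_asym ba ->].
move=> [v w]; rewrite mem_cat; apply/allpairsPdep/orP.
  move=> [a [b [_ + [-> ->]]]]; rewrite mem_neighbors => /orP[ab|ba].
    by left.
  by right; apply/mapP; exists (b, a).
move=> vw; have adj : Defs.adjacent G v w.
  apply/orP; case: vw => [->|/mapP[[a b] ab [-> ->]]]; first by left.
  by right.
by exists v, w; rewrite mem_neighbors (adjacent_vertices adj).1.
Qed.

Lemma sum_sub_neighbors_edges (W : {fset lattice_point}) h : W `<=` vertices G ->
  \sum_(v <- W) \sum_(w <- neighbors G v) h v w =
  \sum_(e <- edges G) ((if e.1 \in W then h e.1 e.2 else 0) +
                       (if e.2 \in W then h e.2 e.1 else 0)).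
Proof.
move=> WV; rewrite -(sum_neighbors_edges (fun v w => if v \in W then h v w else 0)).
rewrite -(big_fset_incl _ WV) => [|v _ /negbTE vW]; last first.
  by rewrite big1// => w _; rewrite vW.
by apply: eq_big_seq => v vW; apply: eq_bigr => w _; rewrite vW.
Qed.
End EdgeSums.

Lemma mem_fset_sep (T : choiceType) (A : {fset T}) (p : pred T) x :
  (x \in [fset y in A | p y]) = (x \in A) && p x.
Proof. by rewrite !inE. Qed.

(** * Gaps between values and uniform bounds *)

Section Gap.
Variable R : realType.

(** Pigeonhole: if each of the first [size s] half-open intervals of length [L] above [f x]
    contained a value, then together with [x] the sequence would have more than [size s] entries. *)
Lemma level_gap (T : eqType) (s : seq T) (f : T -> R) x y L : x \in s ->
  f x + (size s)%:R * L < f y -> 0 <= L ->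
  exists a, [/\ f x <= a, a + L < f y
              & forall v, v \in s -> f v <= a \/ a + L < f v].
Proof.
move=> xs xy L0; apply: contrapT => nogap.
suff H k : (k <= size s)%N -> (k < count (fun v => f v <= f x + k%:R * L)%R s)%N.
  by have := H _ (leqnn _); rewrite ltnNge count_size.
elim: k => [_|k IH ks].
  by rewrite -has_count; apply/hasP; exists x; rewrite //= mul0r addr0.
set a := f x + k%:R * L.
have aS : f x + k.+1%:R * L = a + L by rewrite /a -natr1 mulrDl mul1r addrA.
rewrite aS; set p1 := fun v : T => f v <= a; set p2 := fun v : T => f v <= a + L.
have [v vs /andP[v1 v2]] : exists2 v, v \in s & (a < f v) && (f v <= a + L).
  apply: contrapT => nov; apply: nogap; exists a; split.
  - by rewrite lerDl mulr_ge0.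
  - apply: le_lt_trans xy; rewrite -aS lerD2l ler_wpM2r// ler_nat.
    exact: ks.
  - move=> v vs; case: (leP (f v) a) => [|av]; [by left|right].
    by rewrite ltNge; apply/negP => va; apply: nov; exists v; rewrite // av va.
have lt : (k < count p1 s)%N := IH (ltnW ks).
have le : (count p1 s + count (fun v => (a < f v)%R && (f v <= a + L)%R) s <= count p2 s)%N.
  rewrite -count_predUI (@eq_count _ (predI _ _) pred0) ?count_pred0 ?addn0.
    apply: sub_count => u /orP[]; rewrite /p1 /p2 ; last by case/andP.
    by move/le_trans; apply; rewrite lerDl.
  by move=> u /=; rewrite /p1 ltNge; case: (f u <= a).
apply: leq_trans le; rewrite -(addn1 k.+1); apply: leq_add => //.
by rewrite -has_count; apply/hasP; exists v; rewrite //= v1 v2.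
Qed.

Lemma uniform_bound (T : eqType) (s : seq T) (Q : T -> R -> Prop) :
  (forall x a b, a <= b -> Q x a -> Q x b) ->
  (forall x, x \in s -> exists a, Q x a) ->
  exists2 a, 0 <= a & forall x, x \in s -> Q x a.
Proof.
move=> mono; elim: s => [_|x s IH H]; first by exists 0.
have [a a0 aP] := IH (fun y ys => H y (mem_behead (s := x :: s) ys)).
have [b bP] := H x (mem_head _ _).
exists (Num.max a b); first by rewrite le_max a0.
move=> y; rewrite inE => /predU1P[->|ys].
  by apply: mono bP; rewrite le_max lexx orbT.
by apply: mono (aP y ys); rewrite le_max lexx.
Qed.

(** [gd] comes arbitrarily close to its supremum pi/2: as [gd (ln y) = 2 * atan y - pi / 2], it
    suffices that [atan y] exceeds the midpoint [th] of [eta] and pi/2. *)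
Lemma gd_unbounded (eta : R) : eta < pi / 2 -> exists x, eta < gd x.
Proof.
move=> e2; pose th := (eta + pi / 2) / 2.
have [th0|th0] := leP th 0.
  by exists 0; rewrite gd0; move: th0; rewrite /th; have := pi_gt0 R; lra.
have tI : - (pi / 2) < th < pi / 2.
  by rewrite /th; have := pi_gt0 R; move: th0; rewrite /th => ? ?; apply/andP; split; lra.
pose y := Num.max 0 (tan th) + 1.
have y0 : 0 < y by rewrite ltr_wpDl// le_max lexx.
exists (ln y); rewrite /gd lnK ?posrE//.
have : th < atan y.
  rewrite -[ltLHS]tanK ?in_itv//= lt_atan// /y.
  have : tan th <= Num.max 0 (tan th) by rewrite le_max lexx orbT.
  lra.
rewrite /th; lra.
Qed.
End Gap.

(** * Solving the Neumann problem for the rho-radii *)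

Section Neumann.
Variables (R : realType) (G : {fset lattice_point}) (Phi : lattice_point -> R).
Hypothesis vertices_neq0 : vertices G != fset0.
Hypothesis total : \sum_(v <- vertices G) Phi v = pi * #|` edges G |%:R.
Hypothesis admissible : admissible_angles G Phi.

Let H (rho : lattice_point -> R) v := rho_equation G Phi rho v.

Lemma rho_equation_gd rho v : rho_equation G Phi rho v =
  \sum_(w <- neighbors G v) gd (rho v - rho w) -
  (\sum_(w <- neighbors G v) (pi / 2) - Phi v).
Proof.
rewrite opprB addrCA -sumrB; congr (_ + _); apply: eq_bigr => w _.
by rewrite /gd; field.
Qed.

Let touch (W : {fset lattice_point}) :=
  [fset e in edges G | (e.1 \in W) || (e.2 \in W)].

Lemma sum_rho_equation rho (W : {fset lattice_point}) : W `<=` vertices G ->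
  \sum_(v <- W) H rho v = \sum_(v <- W) Phi v +
  \sum_(e <- edges G)
    ((if e.1 \in W then gd (rho e.1 - rho e.2) - pi / 2 else 0) +
     (if e.2 \in W then gd (rho e.2 - rho e.1) - pi / 2 else 0)).
Proof.
move=> WV; rewrite /H /rho_equation big_split /=; congr (_ + _).
rewrite sum_sub_neighbors_edges//; apply: eq_bigr => e _.
have E x : 2 * atan (expR x) - pi = gd x - pi / 2 by rewrite /gd; field.
by rewrite !E.
Qed.

(** As [gd] is odd, the two ends of each edge together contribute -pi, which balances the prescribed
    total. *)
Lemma sum_rho_equation_eq0 rho : \sum_(v <- vertices G) H rho v = 0.
Proof.
rewrite sum_rho_equation ?fsubset_refl// total.
rewrite (eq_big_seq (fun=> - pi)); last first.
  move=> [v w] /edges_vertices[/= -> ->].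
  by rewrite -(opprB (rho v)) gdN; field.
by rewrite big_const_seq count_predT iter_addr_0 mulNrn -(mulr_natr pi) subrr.
Qed.

(** Admissibility is strict on finitely many sets and [pi / 2 + gd L] approaches pi, so a single [L]
    serves all of them. *)
Lemma admissible_gap : exists2 L, 0 <= L &
  forall W : {fset lattice_point}, W `<=` vertices G -> W != fset0 ->
    W != vertices G -> \sum_(v <- W) Phi v < (pi / 2 + gd L) * #|` touch W|%:R.
Proof.
pose Q (W : {fset lattice_point}) L := W != fset0 -> W != vertices G ->
  \sum_(v <- W) Phi v < (pi / 2 + gd L) * #|` touch W|%:R.
have [W a b ab Qa W0 WV|W|L L0 LQ] := @uniform_bound R _ (fpowerset (vertices G)) Q.
- apply: lt_le_trans (Qa W0 WV) _; rewrite ler_wpM2r// lerD2l.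
  exact: ler_gd.
- rewrite fpowersetE => WV.
  have [W0|W0] := boolP (W == fset0); first by exists 0; rewrite /Q W0.
  have [WE|WE] := boolP (W == vertices G); first by exists 0; rewrite /Q WE.
  have := admissible WV W0 WE; rewrite -/(touch W).
  have [E|n0] := posnP #|` touch W|.
    by move=> lt; exists 0 => _ _; move: lt; rewrite E !mulr0.
  move: n0; rewrite -(ltr0n R) => n0 lt.
  pose n : R := #|` touch W|%:R.
  have [|L hL] := @gd_unbounded R ((\sum_(v <- W) Phi v) / n - pi / 2).
    have : (\sum_(v <- W) Phi v) / n < pi by rewrite ltr_pdivrMr.
    by lra.
  exists L => _ _; rewrite -ltr_pdivrMr//; lra.
- by exists L => // W WV; apply: LQ; rewrite fpowersetE.
Qed.

(* An edge leaving [W] contributes almost [- pi] at its end point in [W]. *)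
Lemma low_set_lt0 L rho (W : {fset lattice_point}) : 0 <= L ->
  W `<=` vertices G -> \sum_(v <- W) Phi v < (pi / 2 + gd L) * #|` touch W|%:R ->
  (forall v w, v \in W -> w \in vertices G -> w \notin W -> rho v + L <= rho w) ->
  \sum_(v <- W) H rho v < 0.
Proof.
move=> L0 WV lt gap; rewrite sum_rho_equation//.
have : \sum_(e <- edges G)
    ((if e.1 \in W then gd (rho e.1 - rho e.2) - pi / 2 else 0) +
     (if e.2 \in W then gd (rho e.2 - rho e.1) - pi / 2 else 0)) <=
    \sum_(e <- edges G | (e.1 \in W) || (e.2 \in W)) - (pi / 2 + gd L).
  rewrite [leRHS]big_mkcond /= big_seq [leRHS]big_seq.
  apply: ler_sum => -[v w] /edges_vertices[vG wG] /=.
  have gL := gd_lt L; have := pi_gt0 R => p0.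
  have [vW|vW] := boolP (v \in W); have [wW|wW] := boolP (w \in W) => /=.
  - by rewrite -(opprB (rho v)) gdN; lra.
  - have : gd (rho v - rho w) <= gd (- L) by apply: ler_gd; have := gap v w vW wG wW; lra.
    by rewrite gdN; lra.
  - have : gd (rho w - rho v) <= gd (- L) by apply: ler_gd; have := gap w v wW vG vW; lra.
    by rewrite gdN; lra.
  - by rewrite addr0.
have -> : \sum_(e <- edges G | (e.1 \in W) || (e.2 \in W)) - (pi / 2 + gd L) =
    - (pi / 2 + gd L) * #|` touch W|%:R.
  by rewrite big_fset_condE -/(touch W) big_const_seq count_predT iter_addr_0 mulr_natr.
by move: lt; lra.
Qed.

(* Pin [rho v0 = 0] and solve the other equations with an obstacle lying below
   every possible gap; the equation at [v0] follows, as all of them sum to 0. *)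
Lemma neumann_rho : exists rho, forall v, v \in vertices G ->
  rho_equation G Phi rho v = 0.
Proof.
have [v0 v0G] := fset0Pn _ vertices_neq0.
have [L L0 LP] := admissible_gap.
pose n : R := (size (vertices G))%:R.
have nL : 0 <= n * L by rewrite mulr_ge0.
pose U v := (v \in vertices G) && (v != v0).
pose K v := \sum_(w <- neighbors G v) (pi / 2) - Phi v.
have HE rho v : H rho v = \sum_(w <- neighbors G v) gd (rho v - rho w) - K v.
  exact: rho_equation_gd.
have U0 : ~~ U v0 by rewrite /U eqxx andbF.
(* A difference above [n * L] produces a gap of length [L]; [W] collects the vertices below it. *)
have low rho x y : x \in vertices G -> y \in vertices G -> rho x + n * L < rho y ->
    exists (W : {fset lattice_point}) a, [/\ rho x <= a, a < rho y,
      forall v, (v \in W) = (v \in vertices G) && (rho v <= a),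
      W `<=` vertices G & \sum_(v <- W) H rho v < 0].
  move=> xG yG xy; have [a [xa ay gap]] := level_gap xG xy L0.
  pose W := [fset v in vertices G | rho v <= a].
  have WE v : (v \in W) = (v \in vertices G) && (rho v <= a).
    exact: mem_fset_sep.
  have WV : W `<=` vertices G by apply/fsubsetP => v; rewrite WE => /andP[].
  exists W, a; split=> //; first by apply: le_lt_trans ay; rewrite lerDl.
  apply: (low_set_lt0 L0 WV).
    apply: LP => //; first by apply/fset0Pn; exists x; rewrite WE xG.
    apply: contraTneq yG => <-; rewrite WE negb_and -ltNge orbC.
    by rewrite (le_lt_trans _ ay)// lerDl.
  move=> v w; rewrite !WE => /andP[_ va] wG; rewrite wG /= -ltNge => aw.
  by case: (gap w wG) => [|/ltW]; lra.
have [rho [rs bound]|rho [rho0 rhoU]] :=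
    @perron R _ (neighbors G) U K (fun=> 0) (- (n * L) - 1) (n * L).
  (* If [rho v] exceeded [n * L], the sum over the low set containing [v0] would be negative, hence
     that over its complement positive. But values there are positive, so above the obstacle, and
     the subsolution property makes every term nonpositive. *)
  move=> v vU; rewrite leNgt; apply/negP => nv.
  have /andP[vG _] := vU.
  have [|W [a [ra av WE WV]]] := low rho v0 v v0G vG.
    by rewrite rs// add0r.
  rewrite rs// in ra; apply/negP; rewrite -leNgt.
  have := sum_rho_equation_eq0 rho.
  rewrite (big_fsetID _ (fun v => v \in W)) /=.
  rewrite (@eq_fbigl _ _ _ _ _ W) => [|w]; last first.
    by rewrite mem_fset_sep andb_idl// => /(fsubsetP WV).
  move=> /eqP; rewrite addr_eq0 => /eqP->; rewrite oppr_ge0 big_seq.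
  apply: sumr_le0 => w; rewrite mem_fset_sep WE => /andP[wG].
  rewrite wG /= -ltNge => aw; rewrite HE subr_le0.
  have [|h|//] := bound w; last by lra.
  by rewrite /U wG; apply: contraTneq aw => ->; rewrite rs// -leNgt.
have Hge v : v \in vertices G -> v != v0 -> 0 <= H rho v.
  move=> vG v0v; have [|_ h _] := rhoU v; first by rewrite /U vG.
  by rewrite HE subr_ge0.
have H0 v : v \in vertices G -> v != v0 -> H rho v = 0.
  move=> vG v0v; have vU : U v by rewrite /U vG.
  apply/eqP; rewrite eq_le Hge// andbT HE subr_le0.
  (* The obstacle is never attained: otherwise the low set misses [v0], all its terms are
     nonnegative, and its sum cannot be negative. *)
  have [_ _] := rhoU v vU; apply; rewrite ltNge; apply/negP => rv.
  have [|W [a [ra av WE WV]]] := low rho v v0 vG v0G.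
    by rewrite (rho0 v0)//; lra.
  apply/negP; rewrite -leNgt big_seq; apply: sumr_ge0 => w.
  rewrite WE => /andP[wG wa]; apply: Hge => //.
  by apply: contraTneq wa => ->; rewrite -ltNge.
exists rho => v vG; have [->|] := eqVneq v v0; last exact: H0.
have := sum_rho_equation_eq0 rho; rewrite (big_fsetD1 v0)//= big_seq big1 ?addr0//.
by move=> w; rewrite in_fsetD1 => /andP[w0 wG]; apply: H0.
Qed.
End Neumann.

(** * Boundary value problems *)

Section BoundaryValueProblems.
Variables (R : realType) (G : {fset lattice_point}).

Lemma boundary_not_interior v :
  v \in boundary_vertices G -> v \notin interior_vertices G.
Proof.
rewrite mem_boundary mem_interior => /andP[_ v4].
by rewrite negb_and orbC neq_ltn v4.
Qed.

Lemma neighbor_vertex v w : w \in neighbors G v -> w \in vertices G.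
Proof. by rewrite mem_neighbors => /adjacent_vertices[]. Qed.

Lemma seq_pos_lower (T : eqType) (s : seq T) (f : T -> R) :
  (forall x, x \in s -> 0 < f x) ->
  exists2 d, 0 < d & forall x, x \in s -> d <= f x.
Proof.
elim: s => [_|x s IH H]; first by exists 1.
have [d d0 dP] := IH (fun y ys => H y (mem_behead (s := x :: s) ys)).
exists (Num.min d (f x)); first by rewrite lt_min d0 H// mem_head.
move=> y; rewrite inE => /predU1P[->|/dP h]; rewrite ge_min ?lexx ?orbT//.
by rewrite h.
Qed.

Lemma dirichlet_rho (rhoB : lattice_point -> R) :
  (forall v, v \in boundary_vertices G -> 0 < rhoB v) ->
  exists rho : lattice_point -> R,
    (forall v, v \in boundary_vertices G -> rho v = rhoB v) /\
    forall v, v \in interior_vertices G ->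
      \sum_(w <- neighbors G v) gd (rho v - rho w) = 0.
Proof.
move=> B0.
have [x a b ab xa|x _|M M0 BM] :=
    @uniform_bound R _ (boundary_vertices G) (fun v a => rhoB v <= a).
- exact: le_trans ab.
- by exists (rhoB x).
have [rho [rs sub] v vi|rho [rhoB' rhoI]] :=
    @perron R _ (neighbors G) (mem (interior_vertices G)) (fun=> 0) rhoB 0 M.
  have vG : v \in vertices G.
    by have : v \in interior_vertices G := vi; rewrite mem_interior => /andP[].
  rewrite -[rho v]subr0; move: v vG {vi}.
  apply: (@comparison R G rho (fun=> 0)) => v vB.
    rewrite subr0 => Mv; rewrite [leRHS]big1 => [|w _]; last by rewrite subr0 gd0.
    by case: (sub v vB) => // v0; lra.
  by rewrite subr0 rs ?BM//; exact: boundary_not_interior.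
exists rho; have rhoE v : v \in boundary_vertices G -> rho v = rhoB v.
  by move=> vB; apply: rhoB'; exact: boundary_not_interior.
split=> // v vi; have [v_ge0 F_ge0 F_le0] := rhoI v vi.
apply/eqP; rewrite eq_le F_ge0 andbT.
(* On the obstacle, [rho v = 0] is at most every neighboring value, so all summands are
   nonpositive. *)
have [v0|v0] := ltP 0 (rho v); first exact: F_le0.
have {v0} v0 : 0 = rho v by apply/eqP; rewrite eq_le v_ge0 v0.
rewrite big_seq; apply: sumr_le0 => w /neighbor_vertex wG.
rewrite -(gd0 R); apply: ler_gd; rewrite -v0 sub0r oppr_le0.
by case: (vertex_cases wG) => [/rhoI[]//|wB]; rewrite rhoE// ltW// B0.
Qed.

(** [expR rho] must be the sum of the two radii divided by [l]. The area factors as a difference of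
    squares, which shows that this sum is positive and identifies [expR (- rho)]. *)
Lemma rho_radius_of_area (l : R) (C : planar_ring R) : 0 < l -> 0 < outer C ->
  ring_area C = pi * l ^+ 2 ->
  has_rho_radius l C (ln ((outer C + inner C) / l)).
Proof.
move=> l0 o0 /(mulfI (lt0r_neq0 (pi_gt0 R))) oi.
have oiE : (outer C - inner C) * (outer C + inner C) = l ^+ 2 by rewrite -oi; ring.
have l2 : 0 < l ^+ 2 by rewrite exprn_gt0.
have s0 : 0 < outer C + inner C.
  rewrite ltNge; apply/negP => s0.
  have d0 : 0 < outer C - inner C by lra.
  by move: l2; rewrite -oiE pmulr_rgt0// ltNge s0.
have E : expR (ln ((outer C + inner C) / l)) = (outer C + inner C) / l.
  by rewrite lnK// posrE divr_gt0.
have E' : expR (- ln ((outer C + inner C) / l)) = (outer C - inner C) / l.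
  rewrite expRN E; apply: (mulfI (lt0r_neq0 (divr_gt0 s0 l0))).
  rewrite divff ?lt0r_neq0 ?divr_gt0//.
  rewrite -[LHS](divff (lt0r_neq0 l2)) -{1}oiE; field.
  by rewrite lt0r_neq0.
by rewrite /has_rho_radius /cosh /sinh E E'; split; field; rewrite lt0r_neq0.
Qed.

Lemma rho_radius_inj (l : R) (C : planar_ring R) x y : 0 < l ->
  has_rho_radius l C x -> has_rho_radius l C y -> x = y.
Proof.
move=> l0 [ox ix] [oy iy]; apply: expR_inj; rewrite -!coshDsinh.
by apply: (mulfI (lt0r_neq0 l0)); rewrite !mulrDr -ox -ix oy iy.
Qed.

Lemma rho_radius_inner_gt0 (l : R) (C : planar_ring R) x : 0 < l ->
  has_rho_radius l C x -> (0 < inner C) = (0 < x).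
Proof.
by move=> l0 [_ ->]; rewrite pmulr_rgt0// -sgr_cp0 sgr_sinh sgr_cp0.
Qed.

Lemma ring_pattern_flat (l : R) (P : pattern R) (rho : lattice_point -> R) :
  0 < l -> ring_pattern G P ->
  (forall v, v \in vertices G -> has_rho_radius l (P v) (rho v)) ->
  forall v, v \in interior_vertices G ->
    \sum_(w <- neighbors G v) gd (rho v - rho w) = 0.
Proof.
move=> l0 [_ _ _ cone] rad v vi; have := cone v vi.
have vG : v \in vertices G by move: vi; rewrite mem_interior => /andP[].
rewrite /cone_angle (rad v vG).2 (sgrM l) (gtr0_sg l0) sgr_sinh mul1r.
rewrite (eq_big_seq (fun w => Num.sg (rho v) * (pi / 2) - gd (rho v - rho w))).
  by rewrite sumrB !sum_interior_neighbors//; lra.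
by move=> w /neighbor_vertex wG; apply: (kite_angleE l0); apply: rad.
Qed.

Lemma dirichlet_congruent (l : R) (rhoB : lattice_point -> R) (P Q : pattern R) :
  0 < l -> dual_simply_connected G ->
  (forall v, v \in boundary_vertices G -> 0 < rhoB v) ->
  ring_pattern G P -> ring_pattern G Q ->
  has_area G P (pi * l ^+ 2) -> has_area G Q (pi * l ^+ 2) ->
  (forall v, v \in boundary_vertices G -> has_rho_radius l (P v) (rhoB v)) ->
  (forall v, v \in boundary_vertices G -> has_rho_radius l (Q v) (rhoB v)) ->
  congruent G P Q.
Proof.
move=> l0 hGdual B0 hP hQ aP aQ bP bQ.
have [oP _ _ _] := hP; have [oQ _ _ _] := hQ.
pose rP v := ln ((outer (P v) + inner (P v)) / l).
pose rQ v := ln ((outer (Q v) + inner (Q v)) / l).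
have radP v : v \in vertices G -> has_rho_radius l (P v) (rP v).
  by move=> vG; apply: rho_radius_of_area; rewrite ?oP// aP.
have radQ v : v \in vertices G -> has_rho_radius l (Q v) (rQ v).
  by move=> vG; apply: rho_radius_of_area; rewrite ?oQ// aQ.
have BV v : v \in boundary_vertices G -> v \in vertices G.
  by rewrite mem_boundary => /andP[].
have rPB v : v \in boundary_vertices G -> rP v = rhoB v.
  by move=> vB; apply: (rho_radius_inj l0 (radP v (BV v vB)) (bP v vB)).
have rQB v : v \in boundary_vertices G -> rQ v = rhoB v.
  by move=> vB; apply: (rho_radius_inj l0 (radQ v (BV v vB)) (bQ v vB)).
have flatP := ring_pattern_flat l0 hP radP.
have flatQ := ring_pattern_flat l0 hQ radQ.
have PQ v : v \in vertices G -> rP v = rQ v.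
  move=> vG; apply/eqP; rewrite eq_le -subr_le0 -[X in _ && X]subr_le0.
  apply/andP; split; move: v vG; apply: comparison => v.
  - by move=> vi _; rewrite flatP// flatQ.
  - by move=> vB; rewrite rPB// rQB// subrr.
  - by move=> vi _; rewrite flatP// flatQ.
  - by move=> vB; rewrite rPB// rQB// subrr.
apply: (congruent_of_radii hGdual hP hQ) => v vG.
  have [oPv iPv] := radP v vG; have [oQv iQv] := radQ v vG.
  by rewrite oQv iQv oPv iPv PQ.
rewrite (rho_radius_inner_gt0 l0 (radP v vG)).
(* Comparison with 0 gives only weak inequalities, so positivity comes from a uniform lower bound
   [d] of the boundary data. *)
have [d d0 dP] := seq_pos_lower B0.
suff : 0 - rP v <= - d by lra.
move: v vG; apply: (@comparison R G (fun=> 0)) => v.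
  by move=> vi _; rewrite flatP// big1// => w _; rewrite subr0 gd0.
by move=> vB; rewrite rPB//; have := dP v vB; lra.
Qed.

Lemma neumann_flat (Theta rho : lattice_point -> R) h :
  (forall v, v \in vertices G ->
    rho_equation G (prescribed_angle G Theta) rho v = 0) ->
  forall v, v \in interior_vertices G ->
    \sum_(w <- neighbors G v) gd (rho v + h - (rho w + h)) = 0.
Proof.
move=> eqn v vi.
have vG : v \in vertices G by move: vi; rewrite mem_interior => /andP[].
under eq_bigr do rewrite opprD addrACA subrr addr0.
have := eqn v vG; rewrite rho_equation_gd /prescribed_angle ifN.
  by rewrite !sum_interior_neighbors//; lra.
by apply: contraL vi; exact: boundary_not_interior.
Qed.
End BoundaryValueProblems.

Theorem proposition5p1 (R : realType) (G : {fset lattice_point}) (l : R)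
    (hG : complex_simply_connected G) (hGdual : dual_simply_connected G)
    (hl : 0 < l) :
  (* Dirichlet boundary conditions *)
  (forall rhoB : lattice_point -> R,
    (forall v, v \in boundary_vertices G -> 0 < rhoB v) ->
    let solution (P : pattern R) :=
      [/\ ring_pattern G P, has_area G P (pi * l ^+ 2)
        & forall v, v \in boundary_vertices G ->
            has_rho_radius l (P v) (rhoB v)] in
    (exists P, solution P) /\
    (forall P Q, solution P -> solution Q -> congruent G P Q)) /\
  (* Neumann boundary conditions *)
  (forall Theta : lattice_point -> R,
    (forall v, v \in boundary_vertices G -> 0 < Theta v) ->
    \sum_(v <- vertices G) prescribed_angle G Theta v = pi * #|` edges G |%:R ->
    admissible_angles G (prescribed_angle G Theta) ->
    exists (rho : lattice_point -> R) (P : R -> pattern R),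
      [/\ forall v, v \in vertices G ->
            rho_equation G (prescribed_angle G Theta) rho v = 0,
          forall h,
            [/\ ring_pattern G (P h), has_area G (P h) (pi * l ^+ 2)
              & forall v, v \in vertices G ->
                  has_rho_radius l (P h v) (rho v + h)],
          forall h v, v \in boundary_vertices G ->
            positively_oriented (P h v) ->
            cone_angle G (P h) v = Theta v
        & exists h0, forall h, h0 < h ->
            forall v, v \in boundary_vertices G ->
              positively_oriented (P h v)]).
Proof.
split=> [rhoB B0 solution|Theta _ total adm].
  split=> [|P Q [hP aP bP] [hQ aQ bQ]]; last exact: (dirichlet_congruent hl hGdual B0).
  have [rho [rhoE flat]] := dirichlet_rho B0.
  have [P [hP aP rad]] := ring_pattern_of_rho hG hGdual hl flat.
  by exists P; split=> // v vB; rewrite -rhoE.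
have [V0 _ _] := hG.
have [rho eqn] := neumann_rho V0 total adm.
have /choice[P PP] h := ring_pattern_of_rho hG hGdual hl (neumann_flat h eqn).
have BV v : v \in boundary_vertices G -> v \in vertices G.
  by rewrite mem_boundary => /andP[].
have rad h v : has_rho_radius l (P h v) (rho v + h) by have [_ _] := PP h.
exists rho, P; split=> //.
- by move=> h; have [? ? ?] := PP h.
(* At a positive ring each kite angle is [pi / 2 - gd (rho v - rho w)], so the equation at [v] reads
   off the cone angle. *)
- move=> h v vB; rewrite /positively_oriented.
  rewrite (rho_radius_inner_gt0 hl (rad h v)) => v0.
  have := eqn v (BV v vB); rewrite rho_equation_gd /prescribed_angle vB => E.
  rewrite /cone_angle; under eq_bigr do
    rewrite (kite_angleE hl (rad h v) (rad h _)) gtr0_sg// mul1r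
      (opprD (rho _)) (addrACA (rho v)) subrr addr0.
  by rewrite sumrB; lra.
(* [h0] bounds [- rho] on the boundary. *)
- have [v a b ab va|v _|h0 _ h0P] :=
    @uniform_bound R _ (boundary_vertices G) (fun v a => - rho v <= a).
  + exact: le_trans ab.
  + by exists (- rho v).
  exists h0 => h hh v vB; rewrite /positively_oriented.
  by rewrite (rho_radius_inner_gt0 hl (rad h v)); have := h0P v vB; lra.
Qed.
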